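(* Let $X\in\mathcal{X}(\mathbb{C}^n,0)$ be a germ of a holomorphic vector field such that $\mathrm{rank}(DX(0))\ge p+1$, where $p$ is a positive integer. Then $X$ satisfies the division property by $k$-forms for $n-p\le k\le n-1$.
   Context: $\Omega^k(\mathbb{C}^n,0)$ and $\mathcal{X}(\mathbb{C}^n,0)$ denote germs at $0$ of holomorphic $k$-forms and holomorphic vector fields. $X\in\mathcal{X}(\mathbb{C}^n,0)$ satisfies the division property by $k$-forms if for any $\alpha\in\Omega^k(\mathbb{C}^n,0)$ with $i_X\alpha=0$ there exists $\beta\in\Omega^{k+1}(\mathbb{C}^n,0)$ such that $\alpha=i_X\beta$. $DX(0)$ is the Jacobian matrix at $0$ of the coefficients of $X$. *)

(* Defs.v *)
From HB Require Import structures.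
From mathcomp Require Import all_boot all_order all_algebra.
From mathcomp Require Import finmap.
From mathcomp Require Import boolp classical_sets reals topology normedtype.
From mathcomp Require Import landau derive.
From mathcomp.analysis.showcase Require Import summability.
From mathcomp Require Import complex.

Set Implicit Arguments.
Unset Strict Implicit.
Unset Printing Implicit Defensive.

Import Order.TTheory GRing.Theory Num.Theory.
Import numFieldNormedType.Exports.

Local Open Scope classical_set_scope.
Local Open Scope ring_scope.

(* R[i] packed as a numFieldType, so that the norm and topology of the generic
   numFieldType instances are found. *)
Definition Cplx (R : realType) : numFieldType := R[i].

Definition monomial (R : realType) (n : nat)
    (m : {ffun 'I_n -> nat}) (z : 'rV[Cplx R]_n) : Cplx R :=
  \prod_(i < n) z ord0 i ^+ m i.

(* f has, on some neighbourhood of w, an expansion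
     f z = \sum_m c m * (z - w)^m    (m ranging over multi-indices)
   as a multiple power series; the series is summed along the net of finite
   sets of multi-indices, i.e. unconditionally (equivalently, absolutely). *)
Definition power_series_at (R : realType) (n : nat)
    (f : 'rV[Cplx R]_n -> Cplx R) (w : 'rV[Cplx R]_n) : Prop :=
  exists c : {ffun 'I_n -> nat} -> Cplx R,
    \forall z \near w,
      partial_sum (fun m => c m * monomial m (z - w)) @ totally --> f z.

(* f represents a germ at 0 of a holomorphic function: it has a convergent
   power series expansion at each point of a neighbourhood of 0. *)
Definition holomorphic_germ (R : realType) (n : nat)
    (f : 'rV[Cplx R]_n -> Cplx R) : Prop :=
  \forall w \near (0 : 'rV[Cplx R]_n), power_series_at f w.

Definition holomorphic_vector_field (R : realType) (n : nat)
    (X : 'rV[Cplx R]_n -> 'rV[Cplx R]_n) : Prop :=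
  forall i : 'I_n, holomorphic_germ (fun z => X z ord0 i).

(* A k-covector takes its k vector arguments as the rows of a k x n matrix;
   multilinearity and alternation are phrased as in determinant_multilinear
   and determinant_alternate. *)
Definition multilinear_rows (R : realType) (k n : nat)
    (a : 'M[Cplx R]_(k, n) -> Cplx R) : Prop :=
  forall (U V W : 'M[Cplx R]_(k, n)) (i : 'I_k) (b c : Cplx R),
    row i U = b *: row i V + c *: row i W ->
    row' i V = row' i U -> row' i W = row' i U ->
    a U = b * a V + c * a W.

Definition alternating_rows (R : realType) (k n : nat)
    (a : 'M[Cplx R]_(k, n) -> Cplx R) : Prop :=
  forall (V : 'M[Cplx R]_(k, n)) (i j : 'I_k),
    i != j -> row i V = row j V -> a V = 0.

(* Representatives of k-forms; only their values near 0 matter. *)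
Definition form (R : realType) (n k : nat) : Type :=
  'rV[Cplx R]_n -> 'M[Cplx R]_(k, n) -> Cplx R.

(* Requiring holomorphy of z |-> a z V for all V amounts to requiring it of the
   coefficients of a, which are its values on tuples of basis vectors. *)
Definition holomorphic_form (R : realType) (n k : nat) (a : form R n k) : Prop :=
  (\forall z \near (0 : 'rV[Cplx R]_n),
     multilinear_rows (a z) /\ alternating_rows (a z)) /\
  forall V : 'M[Cplx R]_(k, n), holomorphic_germ (fun z => a z V).

Definition germ_eq (R : realType) (n k : nat) (a b : form R n k) : Prop :=
  \forall z \near (0 : 'rV[Cplx R]_n), forall V, a z V = b z V.

Definition form0 (R : realType) (n k : nat) : form R n k := fun _ _ => 0.

(* (i_X a)(v_1, ..., v_(k-1)) = a(X, v_1, ..., v_(k-1)), and i_X a = 0 on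
   0-forms. *)
Definition interior_prod (R : realType) (n : nat)
    (X : 'rV[Cplx R]_n -> 'rV[Cplx R]_n) (k : nat) :
    form R n k -> form R n k.-1 :=
  match k return form R n k -> form R n k.-1 with
  | 0%N => fun _ => @form0 R n 0%N
  | k'.+1 => fun a z V => a z (col_mx (X z) V)
  end.

Definition division_property (R : realType) (n : nat)
    (X : 'rV[Cplx R]_n -> 'rV[Cplx R]_n) (k : nat) : Prop :=
  forall a : form R n k,
    holomorphic_form a -> germ_eq (interior_prod X a) (@form0 R n k.-1) ->
    exists b : form R n k.+1,
      holomorphic_form b /\ germ_eq a (interior_prod X b).

(* Main.v *)
Require Import Defs.
From mathcomp Require Import all_boot all_order all_algebra.
From mathcomp Require Import finmap ring.
From mathcomp Require Import boolp classical_sets reals topology normedtype.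
From mathcomp Require Import prodnormedzmodule landau derive complex.
From mathcomp.analysis.showcase Require Import summability.

Set Implicit Arguments.
Unset Strict Implicit.
Unset Printing Implicit Defensive.

Import Order.TTheory GRing.Theory Num.Theory.
Import numFieldNormedType.Exports.

Local Open Scope classical_set_scope.
Local Open Scope fset_scope.
Local Open Scope ring_scope.

(** Interior product with X is the differential of the Koszul complex of the
    components of X.  If p + 1 of the differentials of the components of X at a
    zero are independent, this complex is exact in degrees k > n - (p + 1), and at
    a point where X does not vanish it is exact in all degrees.

    The proof produces the primitive by a contracting homotopy and a
    perturbation argument, in the Banach spaces of forms whose coefficients are
    power series absolutely convergent on a closed polydisc ([l1_le],
    [form_l1_le]).  Write X = X0 + N.  If X(0) <> 0, the field X0 is the
    constant X(0) and the homotopy is the exterior product with a covector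
    ([homotopy_const]).  If X(0) = 0, the rows of index s a of the Jacobian are
    independent for some injective s, and X0 is the sum of the z_(s a) times these
    rows; its Koszul complex is a tensor product of complexes of length one, each
    contracted by dividing by z_(s a) and multiplying by a dual covector
    ([koszul_homotopy]).  The projection left over takes values in forms
    annihilated by p + 1 independent vectors, which are zero in degree
    k >= n - p ([Alt_vanish], [homotopy_linear]).

    Thus i_X0 H + H i_X0 = 1 on k-forms, and for a form c with i_X c = 0 the
    remainder c - i_X (H c) = - H (i_N c) - i_N (H c) is small as soon as the
    norm of H times the norm of N is.  The homotopy H divides by one coordinate
    z_(s a), so its norm is of the order of the inverse of the corresponding
    radius.  With radii d t for the coordinates z_(s a) and d^2 t for all others
    the norm of N is of order d^2, and the product is of order d
    ([good_scale_zero]).  Iterating, the remainders decay geometrically and the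
    forms H c_q sum to the primitive ([solve_by_iteration]).

    Passing between germs and coefficients uses that products and recentred
    expansions of absolutely convergent series may be computed by exchanging
    sums ([has_sum_exchange]), the identity theorem for power series
    ([series_ev_eq0]), and the fact that the Jacobian at 0 consists of the
    coefficients of degree one ([jacobian_coef]). *)

(** * Unconditional summation of complex families *)

Section Sums.
Variable R : realType.
Local Notation K := (Cplx R).

Definition abssum_le (I : choiceType) (B : K) (c : I -> K) : Prop :=
  forall A : {fset I}, \sum_(i <- A) `|c i| <= B.

(** The convergence of the net of finite partial sums, with a large
    inequality so that bounds pass to limits. *)
Definition has_sum (I : choiceType) (c : I -> K) (s : K) : Prop :=
  forall e : K, 0 < e -> exists A0 : {fset I}, forall A : {fset I},
    A0 `<=` A -> `|s - \sum_(i <- A) c i| <= e.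

Lemma partial_sumE (I : choiceType) (c : I -> K) A :
  partial_sum c A = \sum_(i <- A) c i.
Proof. by rewrite /partial_sum big_seq_fsetE. Qed.

Lemma has_sumP (I : choiceType) (c : I -> K) (s : K) :
  partial_sum c @ totally --> s <-> has_sum c s.
Proof.
split=> [/cvgrPdist_le H e e0|H].
  have [A0 _ HA] := H totally_filter e e0.
  by exists A0 => A /HA /=; rewrite partial_sumE.
apply/(@cvgrPdist_le _ _ _ _ totally_filter) => e e0.
have [A0 HA] := H e e0.
by exists A0 => // A /HA /=; rewrite partial_sumE.
Qed.

(** The supremum property of R, transported to K: the values of T are real
    because they are nonnegative. *)
Lemma near_sup (X : Type) (x1 : X) (T : X -> K) (B e : K) :
  (forall x, 0 <= T x <= B) -> 0 < e ->
  exists x0, forall x, T x <= T x0 + e.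
Proof.
move=> HT e0.
have Tre x : T x = (complex.Re (T x))%:C%C.
  by case/andP: (HT x) => /ger0_Im; case: (T x) => a b /= ->.
have e1 : e = (complex.Re e)%:C%C.
  by case: (e) e0 => a b; rewrite ltcE /= => /andP[/eqP-> _].
have e2 : 0 < complex.Re e by move: e0; rewrite {1}e1 ltcR.
pose E := [set complex.Re (T x) | x in [set: X]].
have supE : has_sup E.
  split; first by exists (complex.Re (T x1)), x1.
  exists (complex.Re B) => _ [x _ <-].
  by case/andP: (HT x) => _; rewrite lecE => /andP[].
have [_ [x0 _ <-] Hx0] := sup_adherent e2 supE.
exists x0 => x; rewrite e1 (Tre x) (Tre x0) -rmorphD /= lecR.
rewrite -lerBlDr; apply: ltW; apply: le_lt_trans Hx0.
by rewrite lerB // ; apply: (ub_le_sup supE.2); exists x.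
Qed.

Lemma sum_fsetD (I : choiceType) (V : nmodType) (c : I -> V) (A0 A : {fset I}) :
  A0 `<=` A ->
  \sum_(i <- A) c i = \sum_(i <- A0) c i + \sum_(i <- A `\` A0) c i.
Proof.
move=> sub; rewrite -big_cat; apply: perm_big.
apply: uniq_perm; rewrite ?fset_uniq //.
  rewrite cat_uniq !fset_uniq /= andbT; apply/hasPn => x /=.
  by rewrite in_fsetD => /andP[].
move=> x; rewrite mem_cat in_fsetD.
by have [/(fsubsetP sub) ->|] := boolP (x \in A0).
Qed.

Lemma sum_fsetU (I : choiceType) (V : nmodType) (c : I -> V) (A0 A : {fset I}) :
  (forall i, i \in A -> i \notin A0) ->
  \sum_(i <- A0 `|` A) c i = \sum_(i <- A0) c i + \sum_(i <- A) c i.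
Proof.
move=> dis; rewrite (@sum_fsetD _ _ _ A0) ?fsubsetUl //; congr (_ + _).
congr (\sum_(i <- enum_fset _) _); apply/fsetP => x.
rewrite in_fsetD in_fsetU.
by have [/dis /negbTE -> //|] := boolP (x \in A); rewrite ?orbF ?andNb.
Qed.

Lemma abssum_ge0 (I : choiceType) (B : K) (c : I -> K) : abssum_le B c -> 0 <= B.
Proof. by move/(_ fset0); rewrite big_seq_fset0. Qed.

Lemma abssum_tail (I : choiceType) (B : K) (c : I -> K) (e : K) :
  abssum_le B c -> 0 < e -> exists A0 : {fset I}, forall A : {fset I},
    (forall i, i \in A -> i \notin A0) -> \sum_(i <- A) `|c i| <= e.
Proof.
move=> Bc e0.
have [A|A0 HA0] := @near_sup {fset I} fset0 (fun A => \sum_(i <- A) `|c i|) B e _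
    e0.
  by rewrite sumr_ge0 //=; apply: Bc.
exists A0 => A dis; have := HA0 (A0 `|` A).
by rewrite sum_fsetU // lerD2l.
Qed.

Lemma normc_ge_Im (x : R[i]) : `|complex.Im x|%:C%C <= `|x|.
Proof.
have := normc_ge_Re (x * 'i%C); rewrite ReiNIm normrN normrM.
suff -> : `|'i%C : R[i]| = 1 by rewrite mulr1.
by rewrite normc_def /= expr0n add0r expr1n sqrtr1.
Qed.

(** The real and the imaginary parts of the finite partial sums are Cauchy
    nets, by [abssum_tail], and R is complete. *)
Lemma abssum_has_sum (I : choiceType) (B : K) (c : I -> K) :
  abssum_le B c -> exists s, has_sum c s.
Proof.
move=> Bc.
have tail (f : K -> R) (e : R) : (forall x y, f (x + y) = f x + f y) -> f 0 = 0 ->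
  (forall x, `|f x|%:C%C <= `|x|) -> 0 < e ->
  exists A0, forall A, A0 `<=` A ->
     `|f (\sum_(i <- A0) c i) - f (\sum_(i <- A) c i)| <= e.
  move=> fD f0 fn e0.
  have e0' : (0 : K) < e%:C%C by rewrite ltcR.
  have [A0 HA0] := abssum_tail Bc e0'.
  exists A0 => A sub; rewrite (sum_fsetD _ sub) fD opprD addNKr normrN.
  rewrite -lecR; apply: le_trans (fn _) _.
  apply: le_trans (ler_norm_sum _ _ _) _.
  by apply: HA0 => i; rewrite in_fsetD => /andP[].
have cv (f : K -> R) : (forall x y, f (x + y) = f x + f y) -> f 0 = 0 ->
  (forall x, `|f x|%:C%C <= `|x|) ->
  exists a, forall e : R, 0 < e -> exists A0 : {fset I}, forall A, A0 `<=` A ->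
     `|a - f (\sum_(i <- A) c i)| <= e.
  move=> fD f0 fn.
  have : cvg ((fun A : {fset I} => f (\sum_(i <- A) c i)) @ totally).
    apply: (@R_complete _ _ (fmap_proper_filter _ totally_filter)).
    apply: (@cauchy_exP _ _ _ (fmap_filter _ totally_filter)) => e e0.
    have [A0 HA0] := tail f (e / 2) fD f0 fn (divr_gt0 e0 (ltr0Sn _ _)).
    exists (f (\sum_(i <- A0) c i)), A0 => // A /HA0 HA.
    rewrite /= -ball_normE /=; apply: le_lt_trans HA _.
    by rewrite ltr_pdivrMr // mulr_natr mulr2n ltrDl.
  move=> /cvg_ex[a /(@cvgrPdist_le _ _ _ _ totally_filter) H]; exists a => e e0.
  have [A0 _ HA] := H e e0.
  by exists A0 => A /HA.
have [||x|a Ha] := cv (@complex.Re R).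
- by case=> ? ? [].
- by [].
- exact: normc_ge_Re.
have [||x|b Hb] := cv (@complex.Im R).
- by case=> ? ? [].
- by [].
- exact: normc_ge_Im.
exists (a +i* b)%C => e e0.
have e1 : e = (complex.Re e)%:C%C.
  by case: (e) e0 => u v; rewrite ltcE /= => /andP[/eqP-> _].
have e2 : 0 < complex.Re e by move: e0; rewrite {1}e1 ltcR.
have e3 : 0 < complex.Re e / 2 by rewrite divr_gt0.
have [A1 H1] := Ha _ e3; have [A2 H2] := Hb _ e3.
exists (A1 `|` A2) => A; rewrite fsubUset => /andP[/H1 h1 /H2 h2].
have -> (z : R[i]) : (a +i* b)%C - z =
  (a - complex.Re z)%:C%C + 'i%C * (b - complex.Im z)%:C%C :> R[i].
  case: z => u v; apply/eqP; rewrite eq_complex /=.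
  by rewrite !(mul0r, mulr0, mul1r, subr0, add0r, addr0, subrr) !eqxx.
apply: le_trans (ler_normD _ _) _.
have -> : e = (complex.Re e / 2)%:C%C + (complex.Re e / 2)%:C%C :> R[i].
  by rewrite -rmorphD -splitr.
apply: lerD.
  by rewrite normc_def /= expr0n addr0 sqrtr_sqr lecR.
by rewrite normrM !normc_def /= !expr0n /=
    add0r addr0 expr1n sqrtr1 mul1r sqrtr_sqr lecR.
Qed.

Definition total_sum (I : choiceType) (c : I -> K) : K := xget 0 (has_sum c).

Lemma total_sumP (I : choiceType) (B : K) (c : I -> K) :
  abssum_le B c -> has_sum c (total_sum c).
Proof. by move=> /abssum_has_sum[s Hs]; rewrite /total_sum;
    apply: (@xgetPex _ 0 (has_sum c)); exists s. Qed.

(** K is only partially ordered, hence the side condition that makes x and y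
    comparable. *)
Lemma le_of_eps (x y : K) : (forall e, 0 < e -> x <= y + e) -> x - y \is Num.real ->
    x <= y.
Proof.
move=> H xyr; rewrite -subr_le0 real_leNgt // ?real0 //; apply/negP => xy.
have := H ((x - y) / 2) (divr_gt0 xy (ltr0Sn _ _)).
by rewrite -lerBlDl ler_pdivlMr // mulr_natr mulr2n gerDl => /(lt_le_trans xy);
    rewrite ltxx.
Qed.

Lemma eq_of_eps (x y : K) : (forall e, 0 < e -> `|x - y| <= e) -> x = y.
Proof.
move=> H; apply/eqP; rewrite -subr_eq0 -normr_le0.
by apply: le_of_eps => [e /H|]; rewrite ?add0r // subr0 normr_real.
Qed.

Lemma has_sum_unique (I : choiceType) (c : I -> K) (s t : K) :
  has_sum c s -> has_sum c t -> s = t.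
Proof.
move=> Hs Ht; apply: eq_of_eps => e e0.
have e2 : 0 < e / 2 by rewrite divr_gt0.
have [A1 H1] := Hs _ e2; have [A2 H2] := Ht _ e2.
have := lerD (H1 _ (fsubsetUl A1 A2)) (H2 _ (fsubsetUr A1 A2)).
rewrite -splitr; apply: le_trans; rewrite [X in _ <= _ + X]distrC.
by apply: le_trans (ler_normD _ _); rewrite subrKA.
Qed.

Lemma total_sumE (I : choiceType) (c : I -> K) (s : K) : has_sum c s ->
    total_sum c = s.
Proof.
move=> Hs; apply: (has_sum_unique _ Hs).
by apply: (@xgetPex _ 0 (has_sum c)); exists s.
Qed.

Lemma has_sum_norm_le (I : choiceType) (c : I -> K) (s B : K) :
  abssum_le B c -> has_sum c s -> `|s| <= B.
Proof.
move=> Bc Hs; apply: le_of_eps => [e e0|]; last first.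
  by rewrite rpredB ?normr_real // ger0_real ?(abssum_ge0 Bc).
have [A0 H0] := Hs _ e0.
have -> : s = \sum_(i <- A0) c i + (s - \sum_(i <- A0) c i) by rewrite addrC subrK.
apply: le_trans (ler_normD _ _) _; apply: lerD; last exact: H0.
by apply: le_trans (ler_norm_sum _ _ _) _; apply: Bc.
Qed.

Lemma has_sumD (I : choiceType) (c d : I -> K) (s t : K) :
  has_sum c s -> has_sum d t -> has_sum (fun i => c i + d i) (s + t).
Proof.
move=> Hs Ht e e0.
have e2 : 0 < e / 2 by rewrite divr_gt0.
have [A1 H1] := Hs _ e2; have [A2 H2] := Ht _ e2.
exists (A1 `|` A2) => A; rewrite fsubUset => /andP[/H1 h1 /H2 h2].
rewrite big_split /= opprD addrACA (splitr e).
by apply: le_trans (ler_normD _ _) _; apply: lerD.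
Qed.

Lemma has_sumZ (I : choiceType) (a : K) (c : I -> K) (s : K) :
  has_sum c s -> has_sum (fun i => a * c i) (a * s).
Proof.
move=> Hs e e0.
have a1 : 0 < `|a| + 1 by rewrite ltr_wpDl.
have [A1 H1] := Hs _ (divr_gt0 e0 a1).
exists A1 => A /H1; rewrite ler_pdivlMr // => h.
rewrite -mulr_sumr -mulrBr normrM; apply: le_trans h.
by rewrite mulrC ler_wpM2l // lerDl.
Qed.

Lemma has_sum0 (I : choiceType) : has_sum (fun _ : I => 0) 0.
Proof. by move=> e /ltW e0; exists fset0 => A _; rewrite big1 // subr0 normr0. Qed.

Lemma has_sum_sum (I : choiceType) (J : Type) (r : seq J) (c : J -> I -> K)
    (s : J -> K) :
  (forall j, has_sum (c j) (s j)) ->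
  has_sum (fun i => \sum_(j <- r) c j i) (\sum_(j <- r) s j).
Proof.
move=> H; elim: r => [|j r IH].
  rewrite big_nil (_ : (fun i => _) = fun _ => 0); first exact: has_sum0.
  by apply/funext => i; rewrite big_nil.
rewrite big_cons (_ : (fun i => _) = fun i => c j i + \sum_(j <- r) c j i).
  exact: has_sumD.
by apply/funext => i; rewrite big_cons.
Qed.

Lemma has_sum_fin (I : choiceType) (c : I -> K) (A0 : {fset I}) :
  (forall i, i \notin A0 -> c i = 0) -> has_sum c (\sum_(i <- A0) c i).
Proof.
move=> H e /ltW e0; exists A0 => A sub; rewrite (sum_fsetD _ sub).
rewrite opprD addrA subrr add0r big_seq big1 ?oppr0 ?normr0 // => i.
by rewrite in_fsetD => /andP[/H].
Qed.

(** Reindexing along an injection f whose left inverse g is explicit; the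
    terms outside the image of f vanish. *)
Lemma sum_can (I J : choiceType) (V : nmodType) (f : J -> I) (g : I -> J)
    (c : I -> V) (A : {fset I}) :
  cancel f g -> (forall i, f (g i) != i -> c i = 0) ->
  \sum_(i <- A) c i = \sum_(j <- g @` [fset i in A | f (g i) == i]) c (f j).
Proof.
move=> fK c0; rewrite big_imfset /=; last first.
  by move=> i j /=; rewrite !inE => /andP[_ /eqP fi] /andP[_ /eqP fj] gij;
      rewrite -fi -fj gij.
rewrite (bigID (fun i => f (g i) == i)) /= [X in _ + X]big1 ?addr0;
    last by move=> i /c0.
rewrite -big_filter [RHS](eq_big_seq c); last first.
  by move=> i; rewrite !inE => /andP[_ /eqP->].
apply: perm_big; apply: uniq_perm; rewrite ?filter_uniq ?fset_uniq //.
by move=> i; rewrite mem_filter !inE andbC.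
Qed.

Lemma has_sum_can (I J : choiceType) (f : J -> I) (g : I -> J) (c : I -> K) (s : K)
    :
  cancel f g -> (forall i, f (g i) != i -> c i = 0) ->
  has_sum (fun j => c (f j)) s -> has_sum c s.
Proof.
move=> fK c0 Hs e e0; have [A0 HA] := Hs _ e0.
exists (f @` A0) => A sub; rewrite (sum_can _ fK) //; apply: HA.
apply/fsubsetP => j jA0; apply/imfsetP; exists (f j) => /=; last by rewrite fK.
by rewrite !inE fK eqxx andbT; apply: (fsubsetP sub); apply: in_imfset.
Qed.

Lemma abssum_can (I J : choiceType) (f : J -> I) (g : I -> J) (c : I -> K) (B : K) :
  cancel f g -> (forall i, f (g i) != i -> c i = 0) ->
  abssum_le B (fun j => c (f j)) -> abssum_le B c.
Proof.
move=> fK c0 H A; rewrite (@sum_can _ _ _ f g) //.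
by move=> i /c0 ->; rewrite normr0.
Qed.

Lemma abssum_inj (I J : choiceType) (f : J -> I) (c : I -> K) (B : K) :
  injective f -> abssum_le B c -> abssum_le B (fun j => c (f j)).
Proof.
move=> finj H A; have := H (f @` A); apply: le_trans.
by rewrite big_imfset //= => i j _ _ /finj.
Qed.

Lemma abssum_dominated (I : choiceType) (c d : I -> K) (B : K) :
  (forall i, `|c i| <= `|d i|) -> abssum_le B d -> abssum_le B c.
Proof. by move=> H Bd A; apply: le_trans (Bd A); apply: ler_sum. Qed.

Lemma abssum_weak (I : choiceType) (c : I -> K) (B B' : K) :
  B <= B' -> abssum_le B c -> abssum_le B' c.
Proof. by move=> H Bc A; apply: le_trans H. Qed.

Lemma abssumD (I : choiceType) (c d : I -> K) (B B' : K) :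
  abssum_le B c -> abssum_le B' d -> abssum_le (B + B') (fun i => c i + d i).
Proof.
move=> Bc Bd A; apply: le_trans (lerD (Bc A) (Bd A)).
by rewrite -big_split; apply: ler_sum => i _; apply: ler_normD.
Qed.

Lemma abssumZ (I : choiceType) (a : K) (c : I -> K) (B : K) :
  abssum_le B c -> abssum_le (`|a| * B) (fun i => a * c i).
Proof.
move=> Bc A; under eq_bigr do rewrite normrM.
by rewrite -mulr_sumr ler_wpM2l.
Qed.

Lemma abssum0 (I : choiceType) : abssum_le 0 (fun _ : I => 0).
Proof. by move=> A; rewrite big1 // => i _; rewrite normr0. Qed.

Lemma abssum_sum (I : choiceType) (J : Type) (r : seq J) (c : J -> I -> K)
    (B : J -> K) :
  (forall j, abssum_le (B j) (c j)) ->
  abssum_le (\sum_(j <- r) B j) (fun i => \sum_(j <- r) c j i).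
Proof.
move=> H A; apply: (@le_trans _ _ (\sum_(i <- A) \sum_(j <- r) `|c j i|)).
  by apply: ler_sum => i _; apply: ler_norm_sum.
by rewrite exchange_big; apply: ler_sum => j _; apply: H.
Qed.

(** Both sides are finite sums over F, so the limit over the inner index may
    be taken with a common finite set of columns. *)
Lemma row_sums_near (I J : choiceType) (g : I -> J -> K) (a : I -> K)
    (F : {fset I}) (F' : {fset J}) (e : K) :
  (forall i, has_sum (g i) (a i)) ->
  (forall G : {fset J}, (forall j, j \in G -> j \notin F') ->
     \sum_(i <- F) \sum_(j <- G) `|g i j| <= e) ->
  `|\sum_(i <- F) a i - \sum_(i <- F) \sum_(j <- F') g i j| <= e.
Proof.
move=> Ha He.
have e0 : 0 <= e by have := He fset0; rewrite big1 => [->//|i _];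
    rewrite big_seq_fset0.
apply: le_of_eps => [d d0|]; last by rewrite rpredB ?normr_real // ger0_real.
have [A0 HA] := has_sum_sum F Ha d0.
have := HA (F' `|` A0) (fsubsetUr _ _).
rewrite exchange_big /= => h.
set t := \sum_(i <- F) \sum_(j <- F') _.
pose u := \sum_(i <- F) \sum_(j <- F' `|` A0) g i j.
have -> : \sum_(i <- F) a i - t = (u - t) + (\sum_(i <- F) a i - u).
  by rewrite [RHS]addrC subrKA.
apply: le_trans (ler_normD _ _) _; apply: lerD => //.
rewrite /u /t -sumrB.
apply: le_trans (He ((F' `|` A0) `\` F') _); last by move=> j;
    rewrite in_fsetD => /andP[].
apply: le_trans (ler_norm_sum _ _ _) _; apply: ler_sum => i _.
rewrite (sum_fsetD _ (fsubsetUl F' A0)) addrC addKr.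
exact: ler_norm_sum.
Qed.

Definition dbl_abssum_le (I J : choiceType) (B : K) (g : I -> J -> K) : Prop :=
  forall (F : {fset I}) (G : {fset J}), \sum_(i <- F) \sum_(j <- G) `|g i j| <= B.

Lemma dbl_abssum_sym (I J : choiceType) (B : K) (g : I -> J -> K) :
  dbl_abssum_le B g -> dbl_abssum_le B (fun j i => g i j).
Proof. by move=> H F G; rewrite exchange_big. Qed.

Lemma dbl_abssum_row (I J : choiceType) (B : K) (g : I -> J -> K) i :
  dbl_abssum_le B g -> abssum_le B (g i).
Proof. by move=> /(_ [fset i]) H A; have := H A; rewrite big_seq_fset1. Qed.

(** The phases sg turn the sum of the moduli of the row sums into the modulus
    of one iterated sum, which is bounded by [row_sums_near] with F' empty. *)
Lemma dbl_abssum_row_sums (I J : choiceType) (B : K) (g : I -> J -> K) (a : I -> K)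
    :
  dbl_abssum_le B g -> (forall i, has_sum (g i) (a i)) -> abssum_le B a.
Proof.
move=> Bg Ha F.
have B0 : 0 <= B by have := Bg fset0 fset0; rewrite big_seq_fset0.
pose sg i : K := if a i == 0 then 0 else `|a i| / a i.
have sg1 i : `|sg i| <= 1.
  rewrite /sg; case: eqVneq => [_|a0]; first by rewrite normr0.
  by rewrite normrM normfV normr_id divff // normr_eq0.
have -> : \sum_(i <- F) `|a i| = `|\sum_(i <- F) sg i * a i|.
  rewrite ger0_norm ?sumr_ge0 // => [|i _]; last first.
    by rewrite /sg; case: eqVneq => [_|a0]; rewrite ?mul0r ?divfK.
  apply: eq_bigr => i _; rewrite /sg; case: eqVneq => [->|a0];
      rewrite ?normr0 ?mul0r ?divfK //.
have := @row_sums_near _ _ (fun i j => sg i * g i j) (fun i => sg i * a i) F fset0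
    B.
rewrite [X in _ - X]big1 => [|i _]; last by rewrite big_seq_fset0.
rewrite subr0; apply=> [i|G _]; first exact: has_sumZ.
apply: le_trans (Bg F G); apply: ler_sum => i _; apply: ler_sum => j _.
by rewrite normrM ler_piMl.
Qed.

(** Fubini for summable double families.  A finite box U x V that almost
    attains the supremum of the box sums of moduli approximates the sum of the
    a i over U as well as the sum of the b j over V, so the two totals agree. *)
Lemma has_sum_exchange (I J : choiceType) (B : K) (g : I -> J -> K) (a : I -> K)
    (b : J -> K) (s : K) :
  dbl_abssum_le B g -> (forall i, has_sum (g i) (a i)) ->
      (forall j, has_sum (fun i => g i j) (b j)) ->
  has_sum a s -> has_sum b s.
Proof.
move=> Bg Ha Hb Hs.
suff -> : s = total_sum b by apply: total_sumP
    (dbl_abssum_row_sums (dbl_abssum_sym Bg) Hb).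
apply: eq_of_eps => e e0.
have Ht := total_sumP (dbl_abssum_row_sums (dbl_abssum_sym Bg) Hb).
have e4 : 0 < e / 2 / 2 by rewrite !divr_gt0.
have [A1 H1] := Hs _ e4; have [A2 H2] := Ht _ e4.
have [[F G] |[F G] HFG] := @near_sup ({fset I} * {fset J})%type (fset0, fset0)
  (fun p => \sum_(i <- p.1) \sum_(j <- p.2) `|g i j|) B _ _ e4.
  by rewrite Bg andbT; apply: sumr_ge0 => i _; apply: sumr_ge0.
pose U := F `|` A1; pose V := G `|` A2.
have mono (F1 : {fset I}) : F `<=` F1 -> \sum_(i <- F) \sum_(j <- V) `|g i j| <=
    \sum_(i <- F1) \sum_(j <- V) `|g i j|.
  by move=> sub; rewrite [leRHS](sum_fsetD _ sub) lerDl sumr_ge0 // => i _;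
      apply: sumr_ge0.
have FGV : \sum_(i <- F) \sum_(j <- G) `|g i j| <=
    \sum_(i <- F) \sum_(j <- V) `|g i j|.
  apply: ler_sum => i _; rewrite [leRHS](sum_fsetD _ (fsubsetUl _ _)) lerDl.
  exact: sumr_ge0.
have FGUV : \sum_(i <- F) \sum_(j <- G) `|g i j| <=
    \sum_(i <- U) \sum_(j <- V) `|g i j|.
  by apply: le_trans FGV (mono _ (fsubsetUl _ _)).
have h1 : `|\sum_(i <- U) a i - \sum_(i <- U) \sum_(j <- V) g i j| <= e / 2 / 2.
  apply: row_sums_near => // W dis.
  have := HFG (U, V `|` W) => /=.
  under eq_bigr do rewrite sum_fsetU //.
  rewrite big_split /= => h; rewrite -(lerD2l
      (\sum_(i <- U) \sum_(j <- V) `|g i j|)).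
  by apply: le_trans h _; rewrite lerD2r.
have h2 : `|\sum_(j <- V) b j - \sum_(j <- V) \sum_(i <- U) g i j| <= e / 2 / 2.
  apply: row_sums_near => // W dis.
  have := HFG (U `|` W, V) => /=.
  rewrite sum_fsetU // [X in _ + X]exchange_big /= => h.
  rewrite -(lerD2l (\sum_(i <- U) \sum_(j <- V) `|g i j|)).
  by apply: le_trans h _; rewrite lerD2r.
rewrite exchange_big /= in h2.
have h3 := H1 U (fsubsetUr _ _); have h4 := H2 V (fsubsetUr _ _).
rewrite distrC in h2; rewrite distrC in h4.
have := lerD (lerD h3 h1) (lerD h2 h4).
rewrite -!splitr; apply: le_trans.
have -> : s - total_sum b = ((s - \sum_(i <- U) a i) +
   (\sum_(i <- U) a i - \sum_(i <- U) \sum_(j <- V) g i j)) +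
  ((\sum_(i <- U) \sum_(j <- V) g i j - \sum_(j <- V) b j) +
      (\sum_(j <- V) b j - total_sum b)).
  by rewrite !subrKA.
apply: le_trans (ler_normD _ _) _.
by apply: lerD; apply: ler_normD.
Qed.

End Sums.

(** * Neighbourhoods in coordinates, and absolute convergence *)

Section Neighbourhoods.
Variable R : realType.
Local Notation K := (Cplx R).

Lemma pos_lower_bound2 (a b : K) : 0 < a -> 0 < b -> exists c : K,
    [/\ 0 < c, c <= a & c <= b].
Proof.
move=> a0 b0; have ab0 : 0 < a + b by rewrite addr_gt0.
exists (a * b / (a + b)); split.
- by rewrite divr_gt0 ?mulr_gt0.
- by rewrite ler_pdivrMr // ler_wpM2l ?lerDr // ltW.
- by rewrite ler_pdivrMr // mulrC ler_wpM2l ?lerDl // ltW.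
Qed.

Lemma nbhs_rowP (n : nat) (w : 'rV[K]_n) (P : set 'rV[K]_n) :
  nbhs w P <-> exists2 e : K, 0 < e & forall z : 'rV[K]_n,
      (forall i, `|z 0 i - w 0 i| <= e) -> P z.
Proof.
split=> [/nbhs_ballP[e /= e0 H]|[e e0 H]].
  exists (e / 2); first by rewrite divr_gt0.
  move=> z Hz; apply: H; split=> // i j; rewrite (ord1 i) -ball_normE /= distrC.
  by apply: le_lt_trans (Hz j) _; rewrite ltr_pdivrMr // mulr_natr mulr2n ltrDl.
apply/nbhs_ballP; exists e => //= z Hz; apply: H => i.
by case: Hz => _ /(_ 0 i); rewrite -ball_normE /= distrC => /ltW.
Qed.

(** Outside of a suitable finite set A0 all finite partial sums have modulus
    at most 2.  Applying this to the indices where the real part (or the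
    imaginary part) has a fixed sign bounds the sum of the moduli. *)
Lemma has_sum_abssum (I : choiceType) (c : I -> K) (s : K) :
  has_sum c s -> exists B, abssum_le B c.
Proof.
move=> Hs; have [A0 HA] := Hs 1 ltr01.
have H2 (A : {fset I}) : (forall i, i \in A -> i \notin A0) ->
    `|\sum_(i <- A) c i| <= 2.
  move=> dis.
  have -> : \sum_(i <- A) c i = (s - \sum_(i <- A0) c i)
      - (s - \sum_(i <- A0 `|` A) c i).
    by rewrite sum_fsetU // opprB addrC subrKA addrC addKr.
  apply: le_trans (ler_normB _ _) _; rewrite -[2]/(1 + 1).
  by apply: lerD; apply: HA; rewrite ?fsubsetUl.
have part (f : K -> R) : (forall x y, f (x + y) = f x + f y) -> f 0 = 0 ->
  (forall x, `|f x|%:C%C <= `|x|) ->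
  forall A : {fset I}, (forall i, i \in A -> i \notin A0) ->
    (\sum_(i <- A) `|f (c i)|)%:C%C <= 4 :> K.
  move=> fD f0 fn A dis.
  have fsum (B : {fset I}) : f (\sum_(i <- B) c i) = \sum_(i <- B) f (c i).
    by apply: (big_morph f).
  rewrite (bigID (fun i => 0 <= f (c i))) /= rmorphD /=.
  have sub (p : pred I) : (`|\sum_(i <- A | p i) f (c i)|)%:C%C <= 2 :> K.
    have -> : \sum_(i <- A | p i) f (c i) = f (\sum_(i <- [fset i in A | p i]) c i).
      rewrite fsum -big_filter; apply: perm_big.
      apply: uniq_perm; rewrite ?filter_uniq ?fset_uniq // => i.
      by rewrite mem_filter !inE andbC.
    apply: le_trans (fn _) _; apply: H2 => i; rewrite !inE => /andP[/dis //].
  rewrite (_ : 4 = 2 + 2 :> K); last by rewrite -natrD.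
  apply: lerD.
    rewrite (eq_bigr (fun i => f (c i))) => [|i /ger0_norm //].
    by have := sub (fun i => 0 <= f (c i)); rewrite ger0_norm // sumr_ge0.
  rewrite (eq_bigr (fun i => - f (c i))) => [|i]; last first.
    by rewrite -ltNge => /ltr0_norm.
  have := sub (fun i => ~~ (0 <= f (c i))); rewrite -normrN -sumrN ger0_norm //.
  by apply: sumr_ge0 => i; rewrite -ltNge oppr_ge0 => /ltW.
exists (\sum_(i <- A0) `|c i| + (4 + 4)) => A.
apply: (@le_trans _ _ (\sum_(i <- A0 `|` A) `|c i|)).
  by rewrite [leRHS](sum_fsetD _ (fsubsetUr A0 A)) lerDl sumr_ge0.
rewrite (sum_fsetD _ (fsubsetUl A0 A)) lerD2l.
set D := _ `\` _.
have dis i : i \in D -> i \notin A0 by rewrite in_fsetD => /andP[].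
apply: (@le_trans _ _ ((\sum_(i <- D) `|complex.Re (c i)|)%:C%C +
    (\sum_(i <- D) `|complex.Im (c i)|)%:C%C)).
  rewrite -rmorphD /= -big_split /= rmorph_sum /=; apply: ler_sum => i _.
  rewrite [in leLHS](complexE (c i)); apply: le_trans (ler_normD _ _) _.
  rewrite rmorphD /=; apply: lerD.
    by rewrite normc_def /= expr0n addr0 sqrtr_sqr lecR.
  by rewrite normrM !normc_def /= !expr0n /=
      add0r addr0 expr1n sqrtr1 mul1r sqrtr_sqr lecR.
apply: lerD; apply: part => //; try by case=> ? ? [].
  exact: normc_ge_Re.
exact: normc_ge_Im.
Qed.

End Neighbourhoods.

(** * Multi-indices *)

Section MultiIndex.
Variable n : nat.
Local Notation M := {ffun 'I_n -> nat}.

Definition mle (l m : M) : bool := [forall i, (l i <= m i)%N].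
Definition madd (l m : M) : M := [ffun i => (l i + m i)%N].
Definition msub (m l : M) : M := [ffun i => (m i - l i)%N].
Definition munit (i : 'I_n) : M := [ffun j => (j == i : nat)].
Definition mzero : M := [ffun=> 0%N].

(** Enumerated through functions into a bounded ordinal, so as to be a finite
    set of multi-indices. *)
Definition box (m : M) : {fset M} :=
  (fun f : {ffun 'I_n -> 'I_(\sum_i m i).+1} => [ffun i => nat_of_ord (f i)])
    @` [fset f in family (fun i => [pred j : 'I_(\sum_i m i).+1 | (j <= m i)%N])].

Lemma mleP (l m : M) : reflect (forall i, (l i <= m i)%N) (mle l m).
Proof. exact: forallP. Qed.

Lemma mem_box (l m : M) : (l \in box m) = mle l m.
Proof.
apply/imfsetP/mleP => [[f /=]|H].
  by rewrite !inE => /familyP H -> i; rewrite ffunE; apply: H.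
have lt i : (l i < (\sum_i m i).+1)%N.
  by rewrite ltnS; apply: leq_trans (H i) _; rewrite (bigD1 i) //= leq_addr.
exists [ffun i => Ordinal (lt i)] => /=; last by apply/ffunP => i; rewrite !ffunE.
by rewrite !inE; apply/familyP => i; rewrite ffunE; apply: H.
Qed.

Lemma maddK (l : M) : cancel (madd l) (msub^~ l).
Proof. by move=> m; apply/ffunP => i; rewrite !ffunE addKn. Qed.

Lemma msubKE (l m : M) : (madd l (msub m l) == m) = mle l m.
Proof.
apply/eqP/mleP => [<- i|H]; first by rewrite !ffunE leq_addr.
by apply/ffunP => i; rewrite !ffunE subnKC.
Qed.

Lemma mle_madd (l m : M) : mle l (madd l m).
Proof. by apply/mleP => i; rewrite ffunE leq_addr. Qed.

Lemma mle_munit (i : 'I_n) (m : M) : mle (munit i) m = (0 < m i)%N.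
Proof.
apply/mleP/idP => [/(_ i)|mi j]; rewrite ffunE ?eqxx //.
by case: eqP => [->|].
Qed.

(** Distributivity of a product of sums, with the choice functions recorded as
    the multi-indices below m. *)
Lemma box_prod (V : comPzRingType) (F : 'I_n -> nat -> V) (m : M) :
  \sum_(l <- box m) \prod_i F i (l i) = \prod_i \sum_(j < (m i).+1) F i j.
Proof.
pose D := (\sum_i m i)%N.
have mD i : (m i <= D)%N by rewrite /D (bigD1 i) //= leq_addr.
transitivity (\prod_i \sum_(j < D.+1 | (j <= m i)%N) F i j); last first.
  apply: eq_bigr => i _; by rewrite (big_ord_widen D.+1 (F i)) ?ltnS.
rewrite bigA_distr_big_dep /box big_imfset /=; last first.
  move=> f g _ _ /ffunP H; apply/ffunP => i; apply: val_inj.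
  by have := H i; rewrite !ffunE.
rewrite [RHS]big_mkcond /= -[RHS]big_enum /= -[RHS]big_mkcond /= -[RHS]big_filter.
rewrite (eq_bigr (fun f : {ffun 'I_n -> 'I_D.+1} => \prod_i F i (f i))); last first.
  by move=> f _; apply: eq_bigr => i _; rewrite ffunE.
apply: perm_big; apply: uniq_perm;
    rewrite ?filter_uniq ?fset_uniq -?enumT ?enum_uniq // => f.
by rewrite mem_filter mem_enum andbT !inE.
Qed.

Lemma no_munit_mzero (m : M) : (forall i, ~~ mle (munit i) m) -> m = mzero.
Proof.
move=> H; apply/ffunP => i; rewrite ffunE.
by apply/eqP; rewrite -leqn0 leqNgt -mle_munit.
Qed.

End MultiIndex.

(** * Power series in the weighted l1 norm *)

Section PowerSeries.
Variables (R : realType) (n : nat).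
Local Notation K := (Cplx R).
Local Notation M := {ffun 'I_n -> nat}.
Implicit Types (a b c : M -> K) (z w r : 'rV[K]_n) (m l : M) (B : K).

Definition pos_radii r := forall i, 0 < r 0 i.
Definition polydisc r z := forall i, `|z 0 i| <= r 0 i.

Lemma polydisc_radii r : pos_radii r -> polydisc r r.
Proof. by move=> H i; rewrite ger0_norm // ltW. Qed.

Lemma monomial_madd l m z : monomial (madd l m) z = monomial l z * monomial m z.
Proof. by rewrite -big_split; apply: eq_bigr => i _; rewrite ffunE exprD. Qed.

Lemma monomial_munit i z : monomial (munit i) z = z 0 i.
Proof.
rewrite /monomial (bigD1 i) //= ffunE eqxx expr1 big1 ?mulr1 // => j /negbTE ji.
by rewrite ffunE ji expr0.
Qed.

Lemma monomial_mzero z : monomial (mzero n) z = 1.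
Proof. by rewrite /monomial big1 // => i _; rewrite ffunE expr0. Qed.

Lemma monomial_gt0 m r : pos_radii r -> 0 < monomial m r.
Proof. by move=> H; apply: prodr_gt0 => i _; apply: exprn_gt0. Qed.

Lemma norm_monomial m r z : polydisc r z -> `|monomial m z| <= `|monomial m r|.
Proof.
move=> H; rewrite !normr_prod; apply: ler_prod => i _.
rewrite normr_ge0 !normrX; apply: lerXn2r; rewrite ?nnegrE //.
by apply: le_trans (H i) _; rewrite real_ler_norm // ger0_real // (le_trans _
    (H i)).
Qed.

(** The norm of the Banach algebra of the power series that converge
    absolutely on the closed polydisc of polyradius r is at most B. *)
Definition l1_le r B c := abssum_le B (fun m => c m * monomial m r).

Definition series_ev c z : K := total_sum (fun m => c m * monomial m z).

Lemma l1_le_at r B c z : polydisc r z -> l1_le r B c ->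
    abssum_le B (fun m => c m * monomial m z).
Proof.
move=> rz; apply: abssum_dominated => m; rewrite !normrM ler_wpM2l //.
exact: norm_monomial.
Qed.

Lemma l1_le_sub r r' B c : polydisc r r' -> l1_le r B c -> l1_le r' B c.
Proof. exact: l1_le_at. Qed.

Lemma series_evP r B c z : polydisc r z -> l1_le r B c ->
  has_sum (fun m => c m * monomial m z) (series_ev c z).
Proof. by move=> rz /(l1_le_at rz)/total_sumP. Qed.

Lemma series_ev_norm_le r B c z :
  polydisc r z -> l1_le r B c -> `|series_ev c z| <= B.
Proof. by move=> rz cB; apply: has_sum_norm_le (series_evP rz cB);
    apply: l1_le_at cB. Qed.

Lemma l1_leD r B B' a b : l1_le r B a -> l1_le r B' b ->
    l1_le r (B + B') (fun m => a m + b m).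
Proof.
by move=> Ha Hb; rewrite /l1_le; under eq_fun do rewrite mulrDl; apply: abssumD.
Qed.

Lemma l1_leZ r B (x : K) a : l1_le r B a -> l1_le r (`|x| * B) (fun m => x * a m).
Proof.
by move=> Ha; rewrite /l1_le; under eq_fun do rewrite -mulrA; apply: abssumZ.
Qed.

Lemma l1_le_sum r (J : Type) (s : seq J) (a : J -> M -> K) (B : J -> K) :
  (forall j, l1_le r (B j) (a j)) ->
  l1_le r (\sum_(j <- s) B j) (fun m => \sum_(j <- s) a j m).
Proof.
move=> Ha; rewrite /l1_le.
rewrite (_ : (fun m => _) = (fun m => \sum_(j <- s) a j m * monomial m r)).
  exact: abssum_sum.
by apply/funext => m; rewrite mulr_suml.
Qed.

Lemma series_evD r B B' a b z : polydisc r z -> l1_le r B a -> l1_le r B' b ->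
  series_ev (fun m => a m + b m) z = series_ev a z + series_ev b z.
Proof.
move=> rz Ha Hb; apply: total_sumE; under eq_fun do rewrite mulrDl.
by apply: has_sumD; apply: series_evP; eauto.
Qed.

Lemma series_evZ r B a z (x : K) : polydisc r z -> l1_le r B a ->
  series_ev (fun m => x * a m) z = x * series_ev a z.
Proof.
move=> rz Ha; apply: total_sumE; under eq_fun do rewrite -mulrA.
by apply: has_sumZ; apply: series_evP; eauto.
Qed.

Lemma series_ev_sum r (J : Type) (s : seq J) (a : J -> M -> K) (B : J -> K) z :
  polydisc r z -> (forall j, l1_le r (B j) (a j)) ->
  series_ev (fun m => \sum_(j <- s) a j m) z = \sum_(j <- s) series_ev (a j) z.
Proof.
move=> rz Ha; apply: total_sumE.
rewrite (_ : (fun m => _) = (fun m => \sum_(j <- s) a j m * monomial m z));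
    last first.
  by apply/funext => m; rewrite mulr_suml.
by apply: has_sum_sum => j; apply: series_evP; eauto.
Qed.

Definition cauchy_prod (a b : M -> K) (m : M) : K := \sum_(l <- box m) a l *
    b (msub m l).

Let cfam a b l m : K := if mle l m then a l * b (msub m l) else 0.

Let cfam_row a b l z s : has_sum (fun m => b m * monomial m z) s ->
  has_sum (fun m => cfam a b l m * monomial m z) (a l * monomial l z * s).
Proof.
move=> H; apply: (@has_sum_can R _ _ (madd l) (fun m => msub m l)
    (fun m => cfam a b l m * monomial m z)).
- exact: maddK.
- by move=> m; rewrite msubKE /cfam => /negbTE ->; rewrite mul0r.
under eq_fun => m.
  rewrite /cfam mle_madd maddK monomial_madd.
  have -> : a l * b m * (monomial l z * monomial m z) =
    a l * monomial l z * (b m * monomial m z) by rewrite mulrACA.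
  over.
exact: has_sumZ.
Qed.

Let cfam_dsum r Ba Bb a b z : polydisc r z -> l1_le r Ba a -> l1_le r Bb b ->
  dbl_abssum_le (Ba * Bb) (fun l m => cfam a b l m * monomial m z).
Proof.
move=> rz Ha Hb F G.
apply: (@le_trans _ _ (\sum_(l <- F) `|a l * monomial l z| * Bb)); last first.
  rewrite -mulr_suml ler_wpM2r //; first exact: abssum_ge0 Hb.
  exact: l1_le_at rz Ha F.
apply: ler_sum => l _.
apply: (@abssum_can R _ _ (madd l) (fun m => msub m l)
    (fun m => cfam a b l m * monomial m z)).
- exact: maddK.
- by move=> m; rewrite msubKE /cfam => /negbTE ->; rewrite mul0r.
under eq_fun => m.
  rewrite /cfam mle_madd maddK monomial_madd.
  have -> : a l * b m * (monomial l z * monomial m z) =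
    a l * monomial l z * (b m * monomial m z) by rewrite mulrACA.
  over.
by apply: abssumZ; apply: l1_le_at Hb.
Qed.

Let cfam_col a b m z :
  has_sum (fun l => cfam a b l m * monomial m z) (cauchy_prod a b m * monomial m z).
Proof.
have -> : cauchy_prod a b m * monomial m z = \sum_(l <- box m) cfam a b l m *
    monomial m z.
  rewrite mulr_suml; apply: eq_big_seq => l.
  by rewrite mem_box /cfam => ->.
apply: has_sum_fin => l; rewrite mem_box /cfam => /negbTE ->.
by rewrite mul0r.
Qed.

(** The norm is submultiplicative: the double family of the products of two
    terms is absolutely bounded by Ba * Bb, and its column sums are the terms of
    the Cauchy product. *)
Lemma l1_le_cauchy_prod r Ba Bb a b : pos_radii r -> l1_le r Ba a -> l1_le r Bb b ->
  l1_le r (Ba * Bb) (cauchy_prod a b).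
Proof.
move=> r0 Ha Hb; apply: (dbl_abssum_row_sums _ (cfam_col a b ^~ r)).
by apply: dbl_abssum_sym; apply: (@cfam_dsum r); first exact: polydisc_radii.
Qed.

(** The rows of the double family of products sum to a l z^l times the value
    of b, the columns to the terms of the Cauchy product. *)
Lemma series_ev_cauchy_prod r Ba Bb a b z :
  polydisc r z -> l1_le r Ba a -> l1_le r Bb b ->
  series_ev (cauchy_prod a b) z = series_ev a z * series_ev b z.
Proof.
move=> rz Ha Hb; apply: total_sumE.
apply: (has_sum_exchange (cfam_dsum rz Ha Hb) _ (cfam_col a b ^~ z)).
  by move=> l; apply: cfam_row; apply: series_evP; eauto.
rewrite mulrC; under eq_fun do rewrite mulrC.
by apply: has_sumZ; apply: series_evP; eauto.
Qed.

Lemma cauchy_prodDl a b c m : cauchy_prod (fun m => a m + b m) c m =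
    cauchy_prod a c m + cauchy_prod b c m.
Proof. by rewrite -big_split; apply: eq_bigr => l _; rewrite mulrDl. Qed.

Definition mul_coord (i : 'I_n) c m : K :=
  if (0 < m i)%N then c (msub m (munit i)) else 0.
Definition div_coord (i : 'I_n) c m : K := c (madd (munit i) m).
Definition cut_coord (i : 'I_n) c m : K := if m i == 0%N then c m else 0.

Lemma cauchy_prod_monom l0 (x : K) c m :
  cauchy_prod (fun l => x * (l == l0)%:R) c m =
  if mle l0 m then x * c (msub m l0) else 0.
Proof.
have H l : l != l0 -> x * (l == l0)%:R * c (msub m l) = 0.
  by move=> /negbTE->; rewrite mulr0 mul0r.
rewrite /cauchy_prod; case: ifP => lm; last first.
  rewrite big_seq big1 // => l; rewrite mem_box => llm; apply: H.
  by apply: contraTneq llm => ->; rewrite lm.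
have l0b : l0 \in box m by rewrite mem_box.
rewrite (big_fsetD1 l0) //= eqxx mulr1 big_seq big1 ?addr0 // => l.
by rewrite in_fsetD1 => /andP[/H].
Qed.

Lemma cauchy_prod_munit i (x : K) c m :
  cauchy_prod (fun l => x * (l == munit i)%:R) c m = x * mul_coord i c m.
Proof. by rewrite cauchy_prod_monom mle_munit /mul_coord; case: ifP;
    rewrite ?mulr0. Qed.

Lemma msub0 m : msub m (mzero n) = m.
Proof. by apply/ffunP => i; rewrite !ffunE subn0. Qed.

Lemma cauchy_prod_mzero (x : K) c m :
  cauchy_prod (fun l => x * (l == mzero n)%:R) c m = x * c m.
Proof.
rewrite cauchy_prod_monom msub0 ifT //.
by apply/mleP => i; rewrite ffunE.
Qed.

Lemma l1_le_div_coord r B i c : pos_radii r -> l1_le r B c ->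
    l1_le r (B / r 0 i) (div_coord i c).
Proof.
move=> r0 cB; have ri := r0 i.
have := abssumZ (r 0 i)^-1 (abssum_inj (can_inj (maddK (munit i))) cB).
rewrite ger0_norm ?invr_ge0 ?ltW // mulrC; apply: abssum_dominated => m.
rewrite monomial_madd monomial_munit mulrCA mulKf ?gt_eqF //.
Qed.

Lemma l1_le_cut_coord r B i c : l1_le r B c -> l1_le r B (cut_coord i c).
Proof. by apply: abssum_dominated => m; rewrite /cut_coord; case: ifP => // _;
    rewrite mul0r normr0. Qed.

(** Separate the monomials divisible by z_i from the others. *)
Lemma series_ev_split r B i c z : pos_radii r -> polydisc r z -> l1_le r B c ->
  series_ev c z = series_ev (cut_coord i c) z + z 0 i * series_ev (div_coord i c) z.
Proof.
move=> r0 rz cB; apply: total_sumE.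
have -> : (fun m => c m * monomial m z) = (fun m => cut_coord i c m * monomial m z +
   mul_coord i (div_coord i c) m * monomial m z).
  apply/funext => m; rewrite -mulrDl /cut_coord /mul_coord /div_coord;
      congr (_ * _).
  have := msubKE (munit i) m; rewrite mle_munit lt0n.
  by case: (m i =P 0%N) => _ /=; rewrite ?addr0 // => /eqP ->; rewrite add0r.
apply: has_sumD; first by apply: series_evP rz (l1_le_cut_coord _ cB).
apply: (@has_sum_can R _ _ (madd (munit i)) (fun m => msub m (munit i))
  (fun m => mul_coord i (div_coord i c) m * monomial m z)); first exact: maddK.
  by move=> m; rewrite msubKE mle_munit /mul_coord => /negbTE ->; rewrite mul0r.
under eq_fun => m.
  rewrite /mul_coord -mle_munit mle_madd maddK monomial_madd monomial_munit mulrCA.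
  over.
by apply: has_sumZ; apply: series_evP rz (l1_le_div_coord i r0 cB).
Qed.

Lemma series_ev_zero r B c :
  l1_le r B c -> pos_radii r -> series_ev c 0 = c (mzero n).
Proof.
move=> cB r0; apply: total_sumE.
have -> : c (mzero n) = \sum_(m <- [fset mzero n]) c m * monomial m (0 : 'rV[K]_n).
  by rewrite big_seq_fset1 monomial_mzero mulr1.
apply: has_sum_fin => m; rewrite in_fset1 => m0.
suff -> : monomial m (0 : 'rV[K]_n) = 0 by rewrite mulr0.
have [/existsP[i mi]|/existsPn H] := boolP [exists i, mle (munit i) m].
  rewrite /monomial (bigD1 i) //= mxE expr0n.
  by rewrite mle_munit lt0n in mi; rewrite (negbTE mi) mul0r.
by rewrite (no_munit_mzero H) eqxx in m0.
Qed.

Definition small (e : K) z := forall i, `|z 0 i| <= e.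
Definition set_coord (i : 'I_n) (x : K) z : 'rV[K]_n :=
    \row_j (if j == i then x else z 0 j).

Lemma series_ev_cut_coord i c z x : series_ev (cut_coord i c) (set_coord i x z) =
    series_ev c (set_coord i 0 z).
Proof.
congr total_sum; apply/funext => m; rewrite /cut_coord.
have E y : monomial m (set_coord i y z) = y ^+ m i * \prod_(j | j != i) z 0 j ^+ m j.
  rewrite /monomial (bigD1 i) //= mxE eqxx; congr (_ * _).
  by apply: eq_bigr => j /negbTE ji; rewrite mxE ji.
by rewrite !E expr0n; case: eqP => [->|_]; rewrite ?mulr0 ?mul0r ?mulr0.
Qed.

Lemma set_coordK i z : set_coord i (z 0 i) z = z.
Proof. by apply/rowP => j; rewrite mxE; case: eqP => [->|]. Qed.

Lemma set_coord_at i x z : set_coord i x z 0 i = x.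
Proof. by rewrite mxE eqxx. Qed.

(** At points with z_i <> 0 this is [series_ev_split], since the series
    restricted to z_i = 0 vanishes too.  At points with z_i = 0 move to z_i = x
    with x small: the value changes by at most x times a bound. *)
Lemma series_ev_eq0_div_coord r B i c e : pos_radii r -> l1_le r B c -> 0 < e ->
  (forall z, polydisc r z -> small e z -> series_ev c z = 0) ->
  forall z, polydisc r z -> small e z -> series_ev (div_coord i c) z = 0.
Proof.
move=> r0 cB e0 H z rz ez.
have poly x : `|x| <= r 0 i -> polydisc r (set_coord i x z).
  by move=> xr j; rewrite mxE; case: eqP => [->|].
have smal x : `|x| <= e -> small e (set_coord i x z).
  by move=> xr j; rewrite mxE; case: eqP.
have nz x : x != 0 -> `|x| <= r 0 i -> `|x| <= e ->
    series_ev (div_coord i c) (set_coord i x z) = 0.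
  move=> x0 xr xe.
  have := series_ev_split i r0 (poly _ xr) cB.
  rewrite H //; [|exact: poly|exact: smal].
  rewrite series_ev_cut_coord H ?add0r ?set_coord_at; last 2 first.
  - by apply: poly; rewrite normr0 ltW.
  - by apply: smal; rewrite normr0 ltW.
  by move/esym/eqP; rewrite mulf_eq0 (negbTE x0) => /eqP.
have [zi|zi] := eqVneq (z 0 i) 0; last first.
  by rewrite -(set_coordK i z); apply: nz.
apply: eq_of_eps => d d0; rewrite subr0.
have dB := l1_le_div_coord i r0 cB.
have ddB := l1_le_div_coord i r0 dB.
set B' := B / r 0 i / r 0 i in ddB.
have B'0 : 0 <= B' by apply: abssum_ge0 ddB.
have B'1 : 0 < B' + 1 by rewrite ltr_wpDl.
have [x1 [x10 x1r x1e]] := pos_lower_bound2 (r0 i) e0.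
have [x [x0 xx1 xd]] := pos_lower_bound2 x10 (divr_gt0 d0 B'1).
have xn : `|x| = x by rewrite ger0_norm // ltW.
have xr : `|x| <= r 0 i by rewrite xn (le_trans xx1).
have xe : `|x| <= e by rewrite xn (le_trans xx1).
have := series_ev_split i r0 (poly _ xr) dB.
rewrite (nz _ (lt0r_neq0 x0) xr xe) series_ev_cut_coord -[in set_coord i 0 z]zi
    set_coordK set_coord_at.
move/esym/eqP; rewrite addr_eq0 => /eqP ->; rewrite normrN normrM xn.
apply: (@le_trans _ _ (x * B')).
  by apply: ler_wpM2l; [exact: ltW|apply: series_ev_norm_le (poly _ xr) ddB].
move: xd; rewrite ler_pdivlMr //; apply: le_trans.
by rewrite ler_wpM2l ?lerDl // ltW.
Qed.

(** Identity theorem.  A nonzero multi-index m is the sum of a unit and of a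
    smaller one, so the coefficient at m is a coefficient of a divided series,
    which vanishes near 0 as well; the coefficient at 0 is the value at 0. *)
Lemma series_ev_eq0 r B c e : pos_radii r -> l1_le r B c -> 0 < e ->
  (forall z, polydisc r z -> small e z -> series_ev c z = 0) -> forall m, c m = 0.
Proof.
move=> r0 cB e0 H m.
have [k] := ubnP (\sum_i m i)%N; elim: k m B c cB H => // k IH m B c cB H mk.
have [/existsP[i mi]|/existsPn m0] := boolP [exists i, mle (munit i) m]; last first.
  rewrite (no_munit_mzero m0) -(series_ev_zero cB r0); apply: H.
    by move=> i; rewrite mxE normr0 ltW.
  by move=> i; rewrite mxE normr0 ltW.
have mE : madd (munit i) (msub m (munit i)) = m by apply/eqP; rewrite msubKE.
rewrite -mE; apply: (IH (msub m (munit i)) _ (div_coord i c)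
    (l1_le_div_coord i r0 cB)).
  exact: series_ev_eq0_div_coord H.
move: mk; rewrite ltnS; apply: leq_trans; rewrite -[in X in (_ < X)%N]mE.
rewrite mle_munit in mi.
rewrite [X in (_ < X)%N](eq_bigr (fun j => munit i j + msub m (munit i) j))%N.
  rewrite big_split /= -[X in (X < _)%N]add0n ltn_add2r (bigD1 i) //= ffunE eqxx.
  by rewrite add1n.
by move=> j _; rewrite ffunE.
Qed.

Lemma series_ev_inj r B B' c d e : pos_radii r -> l1_le r B c -> l1_le r B' d ->
    0 < e ->
  (forall z, polydisc r z -> small e z -> series_ev c z = series_ev d z) -> c = d.
Proof.
move=> r0 cB dB e0 H; apply/funext => m; apply/eqP; rewrite -subr_eq0; apply/eqP.
have dB' := l1_leZ (-1) dB.
have -> : c m - d m = c m + -1 * d m by rewrite mulN1r.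
apply: (@series_ev_eq0 r _ (fun m => c m + -1 * d m) e) => //;
    first exact: l1_leD cB dB'.
by move=> z rz ez; rewrite (series_evD rz cB dB') (series_evZ _ rz dB) H // mulN1r
    subrr.
Qed.

End PowerSeries.

(** * Holomorphic germs as power series *)

(** The differential of a map that has none is the default linear map 0. *)
Lemma diff_nondifferentiable (K : numDomainType) (V W : normedModType K)
    (f : V -> W) (F : filter_on V) (v : V) :
  ~ differentiable f F -> 'd f F v = 0.
Proof.
move=> nd.
pose P : set {linear V -> W} := fun df => continuous df /\ forall x,
  f x = f (lim F) + df (x - lim F) +o_(x \near F) (x - lim F).
have dP : 'd f F = get P by [].
rewrite dP getPN // => df Pdf; apply: nd; apply/diffP; rewrite dP.
by apply: (@getPex _ P); exists df.
Qed.

Section Germs.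
Variables (R : realType) (n : nat).
Local Notation K := (Cplx R).
Local Notation M := {ffun 'I_n -> nat}.
Implicit Types (a b c : M -> K) (z w r u : 'rV[K]_n) (m l : M) (B : K).

Lemma abssum_fin (I : choiceType) (c : I -> K) (A0 : {fset I}) :
  (forall i, i \notin A0 -> c i = 0) -> abssum_le (\sum_(i <- A0) `|c i|) c.
Proof.
move=> H A; apply: (@le_trans _ _ (\sum_(i <- A0 `|` A) `|c i|)).
  by rewrite [leRHS](sum_fsetD _ (fsubsetUr A0 A)) lerDl sumr_ge0.
rewrite (sum_fsetD _ (fsubsetUl A0 A)) gerDl big_seq big1 //.
by move=> i; rewrite in_fsetD => /andP[/H -> _]; rewrite normr0.
Qed.

Lemma pos_lower_bound (I : finType) (f : I -> K) : (forall i, 0 < f i) ->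
  exists2 e : K, 0 < e & forall i, e <= f i.
Proof.
move=> f0.
suff [e e0 H] : exists2 e : K, 0 < e & forall i, i \in enum I -> e <= f i.
  by exists e => // i; apply: H; rewrite mem_enum.
elim: (enum I) => [|i s [e e0 IH]]; first by exists 1.
have [d [d0 di de]] := pos_lower_bound2 (f0 i) e0.
exists d => // j; rewrite inE => /orP[/eqP -> //|/IH]; exact: le_trans.
Qed.

Lemma polydisc_half r w u : polydisc (2^-1 *: r) w -> polydisc (2^-1 *: r) u ->
  forall i, `|w 0 i| + `|u 0 i| <= r 0 i.
Proof.
move=> Hw Hu i; rewrite (splitr (r 0 i)) ![_ / 2]mulrC; apply: lerD.
  by have := Hw i; rewrite mxE.
by have := Hu i; rewrite mxE.
Qed.

Let rfam c w m l : K :=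
  c m * \prod_i ('C(m i, l i)%:R * w 0 i ^+ (m i - l i)).

Let rfamE c w u m l : rfam c w m l * monomial l u =
  c m * \prod_i (w 0 i ^+ (m i - l i) * u 0 i ^+ l i *+ 'C(m i, l i)).
Proof.
rewrite /rfam -mulrA -big_split; congr (_ * _); apply: eq_bigr => i _ /=.
by rewrite -[RHS]mulr_natl mulrA.
Qed.

Let rfam_out c w m l : l \notin box m -> rfam c w m l = 0.
Proof.
rewrite mem_box => /mleP/existsNP[i /negP]; rewrite -ltnNge => lt.
by rewrite /rfam (bigD1 i) //= bin_small // mul0r mul0r mulr0.
Qed.

Let rfam_row c w u m :
  has_sum (fun l => rfam c w m l * monomial l u) (c m * monomial m (w + u)).
Proof.
have -> : c m * monomial m (w + u) = \sum_(l <- box m) rfam c w m l * monomial l u.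
  rewrite (eq_bigr _ (fun l _ => rfamE c w u m l)) -mulr_sumr; congr (_ * _).
  rewrite (box_prod (fun i j => w 0 i ^+ (m i - j) * u 0 i ^+ j *+ 'C(m i, j))).
  by apply: eq_bigr => i _; rewrite mxE exprDn.
by apply: has_sum_fin => l /rfam_out ->; rewrite mul0r.
Qed.

Let rfam_dsum r B c w u : l1_le r B c -> (forall i, `|w 0 i| + `|u 0 i| <= r 0 i) ->
  dbl_abssum_le B (fun m l => rfam c w m l * monomial l u).
Proof.
move=> cB wu F G; apply: le_trans (cB F); apply: ler_sum => m _.
apply: (@le_trans _ _ (\sum_(l <- box m) `|rfam c w m l * monomial l u|)).
  by apply: abssum_fin => l /rfam_out ->; rewrite mul0r.
rewrite (eq_bigr (fun l => `|c m| * \prod_i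
   (`|w 0 i| ^+ (m i - l i) * `|u 0 i| ^+ l i *+ 'C(m i, l i)))); last first.
  move=> l _; rewrite rfamE normrM normr_prod; congr (_ * _).
  by apply: eq_bigr => i _; rewrite normrMn normrM !normrX.
rewrite -mulr_sumr normrM ler_wpM2l //.
rewrite (box_prod (fun i j => `|w 0 i| ^+ (m i - j) * `|u 0 i| ^+ j *+ 'C(m i, j))).
rewrite normr_prod; apply: ler_prod => i _.
rewrite -exprDn exprn_ge0 ?addr_ge0 // normrX; apply: lerXn2r;
    rewrite ?nnegrE ?addr_ge0 //.
by apply: le_trans (wu i) _; rewrite real_ler_norm // ger0_real // (le_trans _
    (wu i)) ?addr_ge0.
Qed.

(** Taylor expansion around w.  The double family of the binomial terms of
    c m (w + u)^m is absolutely bounded by the bound of c at polyradius r, as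
    |w_i| + |u_i| <= r_i; summing over m first gives the coefficients at w. *)
Lemma series_ev_power_series_at r B c w : pos_radii r -> l1_le r B c ->
    polydisc (2^-1 *: r) w ->
  power_series_at (series_ev c) w.
Proof.
move=> r0 cB Hw.
have r2 : pos_radii (2^-1 *: r) by move=> i; rewrite mxE mulr_gt0 // invr_gt0.
have Hr2 := polydisc_radii r2.
exists (fun l => total_sum (fun m => rfam c w m l)).
have [e e0 He] := pos_lower_bound r2.
apply/nbhs_rowP; exists e => // z Hz.
have Hu : polydisc (2^-1 *: r) (z - w).
  by move=> i; apply: le_trans (He i); rewrite !mxE; apply: Hz.
apply/has_sumP.
apply: (has_sum_exchange (rfam_dsum cB (polydisc_half Hw Hu))
    (rfam_row c w (z - w))) => [l|].
  rewrite mulrC; under eq_fun do rewrite mulrC.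
  apply: has_sumZ.
  have D := dbl_abssum_row l (dbl_abssum_sym (rfam_dsum cB (polydisc_half Hw Hr2))).
  have := abssumZ (monomial l (2^-1 *: r))^-1 D.
  under eq_fun do rewrite mulrC mulfK ?gt_eqF ?monomial_gt0 //.
  exact: total_sumP.
rewrite addrC subrK; apply: series_evP cB.
move=> i; have := polydisc_half Hw Hu i; apply: le_trans.
have {1}-> : z 0 i = w 0 i + (z - w) 0 i by rewrite !mxE subrKC.
exact: ler_normD.
Qed.

Lemma series_ev_holomorphic r B c : pos_radii r -> l1_le r B c ->
    holomorphic_germ (series_ev c).
Proof.
move=> r0 cB.
have r2 : pos_radii (2^-1 *: r) by move=> i; rewrite mxE mulr_gt0 // invr_gt0.
have [e e0 He] := pos_lower_bound r2.
apply/nbhs_rowP; exists e => // z Hz; apply: series_ev_power_series_at cB _ => // i.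
by apply: le_trans (He i); have := Hz i; rewrite mxE subr0.
Qed.

Lemma const_radii (t : K) : 0 < t -> pos_radii (const_mx t : 'rV[K]_n).
Proof. by move=> t0 i; rewrite mxE. Qed.

(** The expansion at 0 converges at the point with all coordinates t, so it
    converges absolutely at polyradius t. *)
Lemma holomorphic_series_ev (f : 'rV[K]_n -> K) : holomorphic_germ f ->
  exists t B c, [/\ 0 < t, l1_le (const_mx t) B c &
    forall z, polydisc (const_mx t) z -> f z = series_ev c z].
Proof.
move=> /nbhs_singleton[c /nbhs_rowP[t t0 H]].
have Ht z : polydisc (const_mx t) z -> has_sum (fun m => c m * monomial m z) (f z).
  move=> Hz; have := H z; rewrite subr0 => h; apply/has_sumP; apply: h => i.
  by have := Hz i; rewrite !mxE subr0.
have [B HB] := has_sum_abssum (Ht _ (polydisc_radii (const_radii t0))).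
by exists t, B, c; split=> // z /Ht /total_sumE.
Qed.

Lemma set_coord_delta (i : 'I_n) (h : K) : h *: delta_mx 0 i =
    set_coord i h (0 : 'rV[K]_n).
Proof.
apply/rowP => j; rewrite !mxE eqxx /=.
by case: eqP; rewrite ?mulr1 ?mulr0.
Qed.

(** A nonzero Jacobian forces X to be differentiable at 0, so that its rows are
    directional derivatives.  Along the i-th axis the difference quotient of the
    j-th component is the value of the series divided by z_i, hence tends to the
    coefficient at the i-th unit. *)
Lemma jacobian_coef (X : 'rV[K]_n -> 'rV[K]_n) (t : K) (B : 'I_n -> K)
    (x : 'I_n -> M -> K) :
  0 < t -> (forall j, l1_le (const_mx t) (B j) (x j)) ->
  (forall z j, polydisc (const_mx t) z -> X z 0 j = series_ev (x j) z) ->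
  jacobian X (0 : 'rV[K]_n) != 0 ->
  forall i j, jacobian X (0 : 'rV[K]_n) i j = x j (munit i).
Proof.
move=> t0 xB Xx J0 i j.
have r0 := const_radii t0.
have dX : differentiable X (0 : 'rV[K]_n).
  apply: contrapT => nd; move/eqP: J0; apply.
  by apply/matrixP => a b; rewrite !mxE diff_nondifferentiable // mxE.
have := deriveEjacobian (delta_mx 0 i) dX.
rewrite -rowE => /rowP /(_ j); rewrite [in RHS]mxE => <-.
have -> : derive X 0 (delta_mx 0 i) = \row_q x q (munit i); last by rewrite mxE.
pose d q := div_coord i (x q).
have dB q : l1_le (const_mx t) (B q / t) (d q).
  by have := l1_le_div_coord i r0 (xB q); rewrite mxE.
have ddB q : l1_le (const_mx t) (B q / t / t) (div_coord i (d q)).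
  by have := l1_le_div_coord i r0 (dB q); rewrite mxE.
have small h : `|h| <= t -> polydisc (const_mx t) (set_coord i h 0 : 'rV[K]_n).
  by move=> ht q; rewrite !mxE; case: eqP => // _; rewrite normr0 ltW.
have set00 : set_coord i 0 0 = 0 :> 'rV[K]_n by rewrite -set_coord_delta scale0r.
have p0 : polydisc (const_mx t) (0 : 'rV[K]_n) by rewrite -set00; apply: small;
    rewrite normr0 ltW.
have quot h q : h != 0 -> `|h| <= t ->
    h^-1 * (X (h *: delta_mx 0 i + 0) 0 q - X 0 0 q) - x q (munit i) =
    h * series_ev (div_coord i (d q)) (set_coord i h 0).
  move=> h0 ht; rewrite addr0 set_coord_delta !Xx //; last exact: small.
  rewrite (series_ev_split i r0 (small _ ht) (xB q)) series_ev_cut_coord set00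
      set_coord_at.
  rewrite (addrC (series_ev (x q) 0)) addrK mulKf //.
  rewrite -/(d q) (series_ev_split i r0 (small _ ht) (dB q)) series_ev_cut_coord
      set00 set_coord_at.
  rewrite (series_ev_zero (dB q) r0) /d /div_coord.
  have -> : madd (munit i) (mzero n) = munit i by apply/ffunP => k;
      rewrite !ffunE addn0.
  by rewrite (addrC (x q (munit i))) addrK.
apply: cvg_lim => //.
move=> P /nbhs_rowP[e e0 He].
have b0 q : 0 <= B q / t / t by apply: abssum_ge0 (ddB q).
have b1 q : 0 < e / (B q / t / t + 1) by rewrite divr_gt0 // ltr_wpDl.
have [f f0 Hf] := pos_lower_bound b1.
have [g [g0 gt gf]] := pos_lower_bound2 t0 f0.
apply/nbhs_ballP; exists g => //= h;
    rewrite -ball_normE /= sub0r normrN => /ltW hg h0.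
apply: He => q; rewrite !mxE quot ?(le_trans hg) // normrM.
apply: (@le_trans _ _ (`|h| * (B q / t / t))).
  by apply: ler_wpM2l => //; apply: series_ev_norm_le (ddB q); apply: small;
      apply: le_trans gt.
have := le_trans (le_trans hg gf) (Hf q); rewrite ler_pdivlMr ?ltr_wpDl //.
by apply: le_trans; rewrite ler_wpM2l // lerDl.
Qed.

End Germs.

(** * Alternating forms by recursion on the first argument *)

Section Alternating.
Variables (R : realType) (n : nat).
Local Notation K := (Cplx R).
Local Notation T k := ('M[K]_(k, n) -> K).

(** Interior product of one vector; [col_mx] puts the vector first. *)
Definition contr k (v : 'rV[K]_n) (a : T k.+1) : T k :=
  fun V => (a : 'M_(1 + k, n) -> K) (col_mx v V).

Definition row0_linear k (a : T k.+1) :=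
    forall (b c : K) (v w : 'rV[K]_n) (V : 'M[K]_(k, n)),
  contr (b *: v + c *: w) a V = b * contr v a V + c * contr w a V.

Definition row01_vanish k : T k -> Prop :=
  match k with
  | k'.+2 => fun a => forall (v : 'rV[K]_n) (V : 'M[K]_(k', n)),
      contr v (contr v a) V = 0
  | _ => fun=> True
  end.

(** Alternating multilinear forms, phrased so that interior products and
    exterior products with covectors can be treated by induction on the degree:
    only the first argument, and the first two together, are inspected. *)
Fixpoint Alt k : T k -> Prop :=
  match k with
  | 0 => fun=> True
  | k'.+1 => fun a => [/\ row0_linear a, forall v, Alt (contr v a) & row01_vanish a]
  end.

Lemma contr_comb k (v : 'rV[K]_n) (a b : T k.+1) (x y : K) :
  contr v (fun V => x * a V + y * b V) = fun V => x * contr v a V + y * contr v b V.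
Proof. by []. Qed.

Lemma mx_split k (V : 'M[K]_(k.+1, n)) : V =
    col_mx (usubmx (V : 'M_(1 + k, n))) (dsubmx (V : 'M_(1 + k, n))).
Proof. by rewrite vsubmxK. Qed.

Lemma contr_eval k (a : T k.+1) (V : 'M[K]_(k.+1, n)) :
  a V = contr (usubmx (V : 'M_(1 + k, n))) a (dsubmx (V : 'M_(1 + k, n))).
Proof. by rewrite /contr vsubmxK. Qed.

Lemma Alt_comb k (a b : T k) (x y : K) : Alt a -> Alt b ->
    Alt (fun V => x * a V + y * b V).
Proof.
elim: k a b => // k IH a b [la ca da] [lb cb db]; split.
- move=> s t v w V; rewrite !contr_comb la lb !mulrDr addrACA.
  by rewrite !(mulrCA x) !(mulrCA y).
- by move=> v; rewrite contr_comb; apply: IH; [apply: ca | apply: cb].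
move: da db; clear IH la ca lb cb; case: k a b => // k a b da db v V.
by rewrite !contr_comb da db !mulr0 addr0.
Qed.

Lemma Alt_zero k : Alt (fun _ : 'M[K]_(k, n) => 0).
Proof.
elim: k => // k IH; split => [b c v w V||]; first by rewrite /contr !mulr0 addr0.
  by move=> v; apply: IH.
by case: k {IH}.
Qed.

Lemma Alt_scale k (a : T k) (x : K) : Alt a -> Alt (fun V => x * a V).
Proof.
move=> /(@Alt_comb _ a (fun=> 0) x 0) /(_ (Alt_zero k)).
by under eq_fun do rewrite mulr0 addr0.
Qed.

Lemma Alt_add k (a b : T k) : Alt a -> Alt b -> Alt (fun V => a V + b V).
Proof.
move=> Ha /(Alt_comb 1 1 Ha).
by under eq_fun do rewrite !mul1r.
Qed.

Lemma Alt_sum k (I : Type) (s : seq I) (a : I -> T k) :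
  (forall i, Alt (a i)) -> Alt (fun V => \sum_(i <- s) a i V).
Proof.
move=> H; elim: s => [|i s IH].
  by under eq_fun do rewrite big_nil; apply: Alt_zero.
by under eq_fun do rewrite big_cons; apply: Alt_add.
Qed.

Lemma Alt_contr k (v : 'rV[K]_n) (a : T k.+1) : Alt a -> Alt (contr v a).
Proof. by case=> _ H _; apply: H. Qed.

Lemma contrD k (v w : 'rV[K]_n) (a : T k.+1) : Alt a ->
  contr (v + w) a = fun V => contr v a V + contr w a V.
Proof.
case=> H _ _; apply/funext => V.
by have := H 1 1 v w V; rewrite !scale1r !mul1r.
Qed.

Lemma contrZ k (x : K) (v : 'rV[K]_n) (a : T k.+1) : Alt a ->
  contr (x *: v) a = fun V => x * contr v a V.
Proof.
case=> H _ _; apply/funext => V.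
by have := H x 0 v 0 V; rewrite scale0r !mul0r !addr0.
Qed.

Lemma contr_sum k (I : Type) (s : seq I) (x : I -> K) (w : I -> 'rV[K]_n)
    (a : T k.+1) :
  Alt a -> contr (\sum_(i <- s) x i *: w i) a = fun V => \sum_(i <- s) x i *
      contr (w i) a V.
Proof.
move=> Ha; apply/funext => V; elim: s => [|i s IH].
  by rewrite !big_nil -(scale0r (0 : 'rV[K]_n)) contrZ // mul0r.
by rewrite !big_cons contrD // contrZ // IH.
Qed.

Lemma contr_basis k (v : 'rV[K]_n) (a : T k.+1) : Alt a ->
  contr v a = fun V => \sum_j v 0 j * contr (delta_mx 0 j) a V.
Proof. by move=> Ha; rewrite [in LHS](row_sum_delta v) contr_sum. Qed.

(** Polarisation of the vanishing on a repeated vector. *)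
Lemma contrC k (v w : 'rV[K]_n) (a : T k.+2) : Alt a ->
  contr v (contr w a) = fun V => - contr w (contr v a) V.
Proof.
move=> Ha; apply/funext => V; apply/eqP; rewrite -addr_eq0 addrC.
case: (Ha) => _ _ d0.
have : contr (v + w) (contr v a) V + contr (v + w) (contr w a) V = 0.
  by rewrite -[RHS](d0 (v + w) V) (contrD v w Ha).
rewrite (contrD _ _ (Alt_contr v Ha)) (contrD _ _ (Alt_contr w Ha)).
by rewrite (d0 v) (d0 w) add0r addr0 => ->.
Qed.

Definition covec (th : 'cV[K]_n) (v : 'rV[K]_n) : K := (v *m th) 0 0.

Lemma covec_lin th (b c : K) v w : covec th (b *: v + c *: w) = b * covec th v + c *
    covec th w.
Proof. by rewrite /covec mulmxDl -!scalemxAl !mxE. Qed.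

(** Exterior product with the covector th, defined by the antiderivation rule
    i_v (th /\ a) = th(v) a - th /\ (i_v a). *)
Fixpoint wedge (th : 'cV[K]_n) k : T k -> T k.+1 :=
  match k return T k -> T k.+1 with
  | 0 => fun a V => covec th (usubmx (V : 'M_(1 + 0, n))) *
      a (dsubmx (V : 'M_(1 + 0, n)))
  | k'.+1 => fun a V =>
      covec th (usubmx (V : 'M_(1 + k'.+1, n))) * a (dsubmx (V : 'M_(1 + k'.+1, n)))
      - wedge th (contr (usubmx (V : 'M_(1 + k'.+1, n))) a)
          (dsubmx (V : 'M_(1 + k'.+1, n)))
  end.

Lemma contr_wedge0 th v (a : T 0) : contr v (wedge th a) = fun V => covec th v *
    a V.
Proof. by apply/funext => V; rewrite /contr /= col_mxKu col_mxKd. Qed.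

Lemma contr_wedge th v k (a : T k.+1) :
  contr v (wedge th a) = fun V => covec th v * a V - wedge th (contr v a) V.
Proof. by apply/funext => V; rewrite /contr /= col_mxKu col_mxKd. Qed.

Lemma wedge_lin th k (a b : T k) (x y : K) :
  wedge th (fun V => x * a V + y * b V) = fun V => x * wedge th a V + y *
      wedge th b V.
Proof.
elim: k a b => [|k IH] a b; apply/funext => V /=.
  by rewrite mulrDr !(mulrCA _ (covec _ _)).
rewrite contr_comb IH opprD mulrDr !mulrBr !(mulrCA _ (covec _ _)).
by rewrite addrACA.
Qed.

Lemma wedge_zero th k : wedge th (fun _ : 'M[K]_(k, n) => 0) = fun=> 0.
Proof.
have := wedge_lin th (fun _ : 'M[K]_(k, n) => 0) (fun=> 0) 0 0.
under eq_fun do rewrite !mul0r addr0.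
by move=> ->; apply/funext => V; rewrite !mul0r addr0.
Qed.

Lemma wedge_sum th k (I : Type) (s : seq I) (a : I -> T k) :
  wedge th (fun V => \sum_(i <- s) a i V) = fun V => \sum_(i <- s) wedge th (a i) V.
Proof.
elim: s => [|i s IH].
  under eq_fun do rewrite big_nil; rewrite wedge_zero.
  by apply/funext => V; rewrite big_nil.
rewrite (_ : (fun V => _) = fun V => 1 * a i V + 1 * \sum_(j <- s) a j V);
    last first.
  by apply/funext => V; rewrite big_cons !mul1r.
by rewrite wedge_lin IH; apply/funext => V; rewrite big_cons !mul1r.
Qed.

(** The antiderivation rule reduces each condition to the same one in lower
    degree; on a repeated vector the two terms th(v) i_v a cancel. *)
Lemma Alt_wedge th k (a : T k) : Alt a -> Alt (wedge th a).
Proof.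
elim: k a => [|k IH] a Ha.
  split => // b c v w V.
  by rewrite !contr_wedge0 covec_lin mulrDl -!mulrA.
split.
- move=> b c v w V; rewrite !contr_wedge covec_lin.
  have -> : contr (b *: v + c *: w) a = fun V => b * contr v a V + c * contr w a V.
    by case: Ha => H _ _; apply/funext.
  by rewrite wedge_lin mulrDl opprD !mulrBr -!mulrA addrACA.
- move=> v; rewrite contr_wedge.
  under eq_fun do rewrite -mulN1r.
  by apply: Alt_comb => //; apply: IH; apply: Alt_contr.
move=> v V; rewrite contr_wedge.
rewrite (_ : (fun V0 => _) = fun V0 => covec th v * a V0 + -1 *
    wedge th (contr v a) V0); last first.
  by apply/funext => U; rewrite mulN1r.
rewrite contr_comb mulN1r; case: k a {IH} Ha V => [|k] a Ha V.
  by rewrite contr_wedge0 subrr.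
rewrite contr_wedge opprB addrCA subrr addr0.
have -> : contr v (contr v a) = fun=> 0 by case: Ha => _ _ H; apply/funext.
by rewrite wedge_zero.
Qed.

(** Induction on the degree of a.  If the first vector v lies in the span of
    the rows of u, the value is a combination of interior products with these
    rows.  Otherwise i_v a is killed by v and by the rows of u, which are
    independent, and the inequality on the dimensions is preserved. *)
Lemma Alt_vanish k r (u : 'M[K]_(r, n)) (a : T k.+1) : Alt a -> row_free u ->
  (n < r + k.+1)%N -> (forall j, contr (row j u) a = fun=> 0) -> forall V, a V = 0.
Proof.
elim: k r u a => [|k IH] r u a Ha fu lt H V.
all: rewrite contr_eval; set v := usubmx _; set V' := dsubmx _.
all: have [/submxP[x ->]|vu] := boolP (v <= u)%MS;
  first by (rewrite mulmx_sum_row contr_sum // big1 // => j _; rewrite H mulr0).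
all: have fu' : row_free (col_mx v u).
1,3: rewrite /row_free eqn_leq rank_leq_row -addsmxE;
  have [le eq] := mxrank_leqif_sup (addsmxSr v u);
  by rewrite add1n -[X in (X < _)%N](eqP fu) ltn_neqAle le eq addsmx_sub
      (negbTE vu).
- have := rank_leq_col (col_mx v u);
    rewrite (eqP fu') add1n -addn1 => /(leq_trans lt).
  by rewrite ltnn.
apply: (IH _ (col_mx v u)) => //; first exact: Alt_contr.
  by rewrite add1n addSnnS.
move=> j; apply/funext => U.
rewrite -[j]splitK; case: (split j) => j' /=.
  rewrite rowKu ord1 (_ : row 0 v = v); last by apply/rowP => q; rewrite mxE.
  by case: Ha => _ _; apply.
by rewrite rowKd contrC // H /contr oppr0.
Qed.

End Alternating.

(** * Comparison with the row-by-row definition *)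

Section AlternatingRows.
Variables (R : realType) (n : nat).
Local Notation K := (Cplx R).
Local Notation T k := ('M[K]_(k, n) -> K).

Lemma usubmx_row k (V : 'M[K]_(k.+1, n)) :
  usubmx (V : 'M_(1 + k, n)) = row ord0 V.
Proof.
apply/rowP => j; rewrite !mxE; congr (V _ _); exact: val_inj.
Qed.

Lemma dsubmx_row' k (V : 'M[K]_(k.+1, n)) :
  dsubmx (V : 'M_(1 + k, n)) = row' ord0 V.
Proof.
apply/matrixP => i j; rewrite !mxE; congr (V _ _); exact: val_inj.
Qed.

Lemma contr_rows k (a : T k.+1) (V : 'M[K]_(k.+1, n)) :
  a V = contr (row ord0 V) a (row' ord0 V).
Proof. by rewrite contr_eval usubmx_row dsubmx_row'. Qed.

Lemma row0_col k (v : 'rV[K]_n) (V : 'M[K]_(k, n)) :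
  row ord0 (col_mx v V : 'M_(k.+1, n)) = v.
Proof. by rewrite -usubmx_row col_mxKu. Qed.

Lemma row'0_col k (v : 'rV[K]_n) (V : 'M[K]_(k, n)) :
  row' ord0 (col_mx v V : 'M_(k.+1, n)) = V.
Proof. by rewrite -dsubmx_row' col_mxKd. Qed.

Lemma row_lift0 k (V : 'M[K]_(k.+1, n)) i : row (lift ord0 i) V =
    row i (row' ord0 V).
Proof. by apply/rowP => j; rewrite !mxE. Qed.

Lemma row_lift_col k (v : 'rV[K]_n) (V : 'M[K]_(k, n)) i :
  row (lift ord0 i) (col_mx v V : 'M_(k.+1, n)) = row i V.
Proof. by rewrite row_lift0 row'0_col. Qed.

Lemma row'P k (U V : 'M[K]_(k, n)) i :
  row' i U = row' i V <-> forall j, j != i -> row j U = row j V.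
Proof.
split=> [H j|H].
  case: (unliftP i j) => [j' ->|->]; last by rewrite eqxx.
  by move=> _; apply/rowP => q; rewrite !mxE; have /matrixP/(_ j' q) := H;
      rewrite !mxE.
apply/matrixP => j q; rewrite !mxE.
have ne : lift i j != i by rewrite eq_sym neq_lift.
by have /rowP/(_ q) := H _ ne; rewrite !mxE.
Qed.

Lemma Alt_multilinear k (a : T k) : Alt a -> multilinear_rows a.
Proof.
elim: k a => [|k IH] a Ha U V W i b c; first by case: i.
case: (unliftP ord0 i) => [i' ->|->] HU HV HW; last first.
  rewrite !(contr_rows a) HU HV HW; case: Ha => l _ _; exact: l.
have rE (Q : 'M[K]_(k.+1, n)) : row' (lift ord0 i') Q = row' (lift ord0 i') U ->
    row ord0 Q = row ord0 U /\ row' i' (row' ord0 Q) = row' i' (row' ord0 U).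
  move=> /row'P H; split; first exact: H.
  by apply/row'P => j ji; rewrite -!row_lift0; apply: H; rewrite (inj_eq lift_inj).
have [V0 V1] := rE _ HV; have [W0 W1] := rE _ HW.
rewrite !(contr_rows a) V0 W0; apply: (IH _ (Alt_contr _ Ha)) V1 W1.
by rewrite -!row_lift0.
Qed.

Lemma Alt_alternating k (a : T k) : Alt a -> alternating_rows a.
Proof.
elim: k a => [|k IH] a Ha V i j; first by case: i.
have first (j' : 'I_k) : row ord0 V = row (lift ord0 j') V -> a V = 0.
  case: k IH a Ha V i j j' => [|k] IH a Ha V i j j'; first by case: j'.
  rewrite row_lift0 (contr_rows a); set v := row ord0 V; set V' := row' ord0 V.
  case: (unliftP ord0 j') => [j2 ->|->] E; rewrite (contr_rows (contr v a)).
    rewrite contrC //; apply/eqP; rewrite oppr_eq0; apply/eqP.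
    apply: (IH _ (Alt_contr (row ord0 V') Ha) (col_mx v (row' ord0 V')) ord0
        (lift ord0 j2)).
      exact: neq_lift.
    by rewrite row0_col row_lift_col E row_lift0.
  by rewrite -E; case: Ha => _ _; apply.
case: (unliftP ord0 i) => [i' ->|->]; case: (unliftP ord0 j) => [j' ->|->].
- rewrite (inj_eq lift_inj) !row_lift0 => ij E; rewrite (contr_rows a).
  exact: (IH _ (Alt_contr _ Ha)) ij E.
- by move=> _ /esym; apply: first.
- by move=> _; apply: first.
by rewrite eqxx.
Qed.

Lemma Alt_of_rows k (a : T k) : multilinear_rows a -> alternating_rows a -> Alt a.
Proof.
elim: k a => // k IH a ml al; split.
- move=> b c v w V; apply: (ml _ _ _ ord0); rewrite ?row0_col ?row'0_col //.
- move=> v; apply: IH.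
    move=> U V W i b c HU HV HW; apply: (ml _ _ _ (lift ord0 i)).
    + by rewrite !row_lift_col.
    + apply/row'P => j; case: (unliftP ord0 j) => [j' ->|->];
        last by rewrite !row0_col.
      by rewrite (inj_eq lift_inj) !row_lift_col; apply: (proj1 (row'P _ _ _) HV).
    + apply/row'P => j; case: (unliftP ord0 j) => [j' ->|->];
        last by rewrite !row0_col.
      by rewrite (inj_eq lift_inj) !row_lift_col; apply: (proj1 (row'P _ _ _) HW).
  move=> V i j ij E; apply: (al _ (lift ord0 i) (lift ord0 j)).
    by rewrite (inj_eq lift_inj).
  by rewrite !row_lift_col.
case: k a ml al {IH} => // k a ml al v V.
apply: (al _ ord0 (lift ord0 ord0)); first exact: neq_lift.
by rewrite row_lift_col !row0_col.
Qed.

Lemma AltP k (a : T k) : Alt a <-> multilinear_rows a /\ alternating_rows a.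
Proof.
split=> [H|[]]; last exact: Alt_of_rows.
by split; [apply: Alt_multilinear | apply: Alt_alternating].
Qed.
End AlternatingRows.

(** * Power series with alternating coefficients *)

Section Families.
Variables (R : realType) (n : nat).
Local Notation K := (Cplx R).
Local Notation T k := ('M[K]_(k, n) -> K).
Local Notation M := {ffun 'I_n -> nat}.
Local Notation F k := (M -> T k).
Local Notation e_ j := (delta_mx 0 j : 'rV[K]_n).
Implicit Types (r z v : 'rV[K]_n) (B : K).

Definition coef_contr k v (c : F k.+1) : F k := fun m => contr v (c m).

Definition Alt_series k (c : F k) := forall m, Alt (c m).

(** The norms of the coefficients on all tuples of basis vectors are at
    most B. *)
Fixpoint form_l1_le r B k : F k -> Prop :=
  match k with
  | 0 => fun c => l1_le r B (fun m => c m 0)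
  | k'.+1 => fun c => forall j, form_l1_le r B (coef_contr (e_ j) c)
  end.

(** Every operation below acts on the coefficient series of each tuple of
    vectors separately, so its norm estimate need only be known for scalar
    series. *)
Lemma form_l1_le_map (I : Type) r r' B' (B : I -> K) (L : (I -> M -> K) -> M -> K) k
    (c : I -> F k) :
  (forall f, (forall i, l1_le r (B i) (f i)) -> l1_le r' B' (L f)) ->
  (forall i, form_l1_le r (B i) (c i)) ->
  form_l1_le r' B' (fun m V => L (fun i m => c i m V) m).
Proof.
move=> HL; elim: k c => [|k IH] c H /=; first exact: HL.
by move=> j; apply: (IH (fun i => coef_contr (e_ j) (c i))) => i; apply: H.
Qed.

Lemma form_l1_le_map1 r r' B B' (L : (M -> K) -> M -> K) k (c : F k) :
  (forall f, l1_le r B f -> l1_le r' B' (L f)) -> form_l1_le r B c ->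
  form_l1_le r' B' (fun m V => L (fun m => c m V) m).
Proof.
move=> HL H.
exact: (@form_l1_le_map unit r r' B' (fun=> B) (fun f => L (f tt)) k (fun=> c)
  (fun f Hf => HL _ (Hf tt)) (fun=> H)).
Qed.

Lemma form_l1_le_weak r r' B B' k (c : F k) :
  polydisc r r' -> B <= B' -> form_l1_le r B c -> form_l1_le r' B' c.
Proof.
move=> rr BB; apply: (@form_l1_le_map1 r r' B B' (fun f => f)) => f.
by move=> /(l1_le_sub rr); apply: abssum_weak.
Qed.

Lemma form_l1_leD r B B' k (c d : F k) : form_l1_le r B c -> form_l1_le r B' d ->
  form_l1_le r (B + B') (fun m V => c m V + d m V).
Proof.
move=> Hc Hd.
apply: (@form_l1_le_map bool r r (B + B') (fun b => if b then B else B')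
  (fun f m => f true m + f false m) k (fun b => if b then c else d)).
  by move=> f Hf; apply: l1_leD; [apply: (Hf true) | apply: (Hf false)].
by case.
Qed.

Lemma form_l1_leZ r B (x : K) k (c : F k) : form_l1_le r B c ->
    form_l1_le r (`|x| * B) (fun m V => x * c m V).
Proof.
by apply: (@form_l1_le_map1 r r B _ (fun f m => x * f m)) => f; apply: l1_leZ.
Qed.

Lemma form_l1_leN r B k (c : F k) : form_l1_le r B c ->
    form_l1_le r B (fun m V => - c m V).
Proof.
apply: (@form_l1_le_map1 r r B _ (fun f m => - f m)) => f.
by apply: abssum_dominated => m; rewrite mulNr normrN.
Qed.

Lemma form_l1_le0 r k : form_l1_le r 0 (fun _ _ => 0 : K) (k := k).
Proof.
elim: k => [|k IH] //=; apply: (abssum_dominated _ (@abssum0 R _)) => m;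
    by rewrite mul0r.
Qed.

Lemma form_l1_le_sum r (J : Type) (s : seq J) (B : J -> K) k (c : J -> F k) :
  (forall j, form_l1_le r (B j) (c j)) ->
  form_l1_le r (\sum_(j <- s) B j) (fun m V => \sum_(j <- s) c j m V).
Proof.
apply: (@form_l1_le_map J r r _ B (fun f m => \sum_(j <- s) f j m)) => f Hf.
exact: l1_le_sum.
Qed.

Lemma covec_delta (th : 'cV[K]_n) j : covec th (e_ j) = th j 0.
Proof. by rewrite /covec -rowE mxE. Qed.

Lemma form_l1_le_trans r B B' k (c : F k) : B <= B' -> form_l1_le r B c ->
    form_l1_le r B' c.
Proof.
move=> BB; apply: (@form_l1_le_map1 r r B B' (fun f => f)) => f.
exact: abssum_weak.
Qed.

Lemma form_l1_le_wedge r B (U : K) (th : 'cV[K]_n) k (c : F k) :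
  0 <= B -> (forall j, `|th j 0| <= U) -> form_l1_le r B c ->
  form_l1_le r (k.+1%:R * U * B) (fun m => wedge th (c m)).
Proof.
move=> B0 HU; elim: k c => [|k IH] c Hc j.
  rewrite mul1r (_ : coef_contr _ _ = fun m V => th j 0 * c m V); last first.
    by apply/funext => m; rewrite /coef_contr contr_wedge0 covec_delta.
  by apply: form_l1_le_trans (form_l1_leZ (th j 0) Hc); rewrite ler_wpM2r.
rewrite (_ : coef_contr _ _ = fun m V => th j 0 *
    c m V - wedge th (coef_contr (e_ j) c m) V); last first.
  by apply/funext => m; rewrite /coef_contr contr_wedge covec_delta.
have -> : k.+2%:R * U * B = U * B + k.+1%:R * U * B.
  by rewrite -[k.+2]add1n natrD mulrDl mul1r mulrDl.
apply: (@form_l1_leD r _ _ _ (fun m V => th j 0 * c m V)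
    (fun m V => - wedge th (coef_contr (e_ j) c m) V)).
  by apply: form_l1_le_trans (form_l1_leZ (th j 0) Hc); rewrite ler_wpM2r.
by apply: form_l1_leN; apply: IH.
Qed.

Lemma form_l1_le_contr r B v k (c : F k.+1) : Alt_series c -> form_l1_le r B c ->
  form_l1_le r ((\sum_j `|v 0 j|) * B) (coef_contr v c).
Proof.
move=> Ac Hc.
rewrite (_ : coef_contr v c = fun m V => \sum_j v 0 j * contr (e_ j) (c m) V);
    last first.
  by apply/funext => m; rewrite /coef_contr contr_basis.
rewrite mulr_suml; apply: (@form_l1_le_sum _ _ _ _ _
    (fun j m V => v 0 j * contr (e_ j) (c m) V)) => j.
by apply: form_l1_leZ; apply: Hc.
Qed.

Lemma Alt_series_coef_contr v k (c : F k.+1) : Alt_series c ->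
    Alt_series (coef_contr v c).
Proof. by move=> Ac m; apply: Alt_contr. Qed.

(** The constant depends on the vectors V alone, which is what sums of
    infinitely many forms require. *)
Lemma form_l1_le_at k (V : 'M[K]_(k, n)) : exists2 C : K, 0 <= C &
  forall r B (c : F k),
  Alt_series c -> form_l1_le r B c -> l1_le r (C * B) (fun m => c m V).
Proof.
elim: k V => [|k IH] V.
  exists 1 => // r B c _ /=; rewrite mul1r (_ : V = 0) //.
  by apply/matrixP => -[].
rewrite (mx_split V); set v := usubmx _;
    have [C C0 H] := IH (dsubmx (V : 'M_(1 + k, n))).
exists (C * \sum_j `|v 0 j|); first by rewrite mulr_ge0 // sumr_ge0.
move=> r B c Ac Hc; rewrite -mulrA.
exact: (H r _ (coef_contr v c) (Alt_series_coef_contr v Ac)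
    (form_l1_le_contr v Ac Hc)).
Qed.

Definition form_ev k (c : F k) z : T k := fun V => series_ev (fun m => c m V) z.

Lemma form_ev_Alt r B k (c : F k) z : polydisc r z -> Alt_series c ->
    form_l1_le r B c -> Alt (form_ev c z).
Proof.
move=> rz; elim: k B c => // k IH B c Ac Hc; split.
- move=> b d v w V; rewrite /contr /form_ev -!/(contr _ _ _).
  rewrite (_ : (fun m => _) = fun m => b * contr v (c m) V + d * contr w (c m) V);
      last first.
    by apply/funext => m; case: (Ac m) => l _ _; apply: l.
  have [C1 _ /(_ _ _ _ Ac Hc) H1] := form_l1_le_at (col_mx v V : 'M_(k.+1, n)).
  have [C2 _ /(_ _ _ _ Ac Hc) H2] := form_l1_le_at (col_mx w V : 'M_(k.+1, n)).
  by rewrite (series_evD rz (l1_leZ b H1) (l1_leZ d H2)) (series_evZ _ rz H1)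
      (series_evZ _ rz H2).
- by move=> v; apply: (IH _ (coef_contr v c));
    [apply: Alt_series_coef_contr | apply: form_l1_le_contr].
case: k {IH Hc} c Ac => // k c Ac v V; rewrite /contr /form_ev -!/(contr _ _ _).
apply: total_sumE; under eq_fun => m.
  rewrite (_ : c m _ = 0); last by case: (Ac m) => _ _; apply.
  rewrite mul0r; over.
exact: has_sum0.
Qed.

(** Interior product with the vector field whose components are the series x,
    on the level of coefficients. *)
Definition field_contr (x : 'I_n -> M -> K) k (c : F k.+1) : F k :=
  fun m V => \sum_j cauchy_prod (x j) (fun l => contr (e_ j) (c l) V) m.

Lemma field_contr_Alt x k (c : F k.+1) : Alt_series c ->
    Alt_series (field_contr x c).
Proof.
move=> Ac m; apply: Alt_sum => j; apply: Alt_sum => l.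
by apply: Alt_scale; apply: Alt_contr.
Qed.

Lemma form_l1_le_field_contr r x B B' k (c : F k.+1) : pos_radii r ->
  (forall j, l1_le r B' (x j)) -> form_l1_le r B c ->
      form_l1_le r (n%:R * B' * B) (field_contr x c).
Proof.
move=> r0 Hx Hc.
have -> : n%:R * B' * B = \sum_(j < n) B' *
    B by rewrite sumr_const card_ord -[RHS]mulr_natl mulrA.
apply: (@form_l1_le_sum _ _ _ _ _
    (fun j m V => cauchy_prod (x j) (fun l => contr (e_ j) (c l) V) m)) => j.
apply: (@form_l1_le_map1 r r B _ (cauchy_prod (x j)) _ (coef_contr (e_ j) c)) =>
    // f.
exact: l1_le_cauchy_prod.
Qed.

Lemma field_contrD x y k (c : F k.+1) m V :
  field_contr (fun j l => x j l + y j l) c m V = field_contr x c m V +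
      field_contr y c m V.
Proof. by rewrite -big_split; apply: eq_bigr => j _; apply: cauchy_prodDl. Qed.

Lemma form_ev_field_contr r x B B' k (c : F k.+1) z V : pos_radii r ->
    polydisc r z ->
  (forall j, l1_le r B' (x j)) -> Alt_series c -> form_l1_le r B c ->
  form_ev (field_contr x c) z V = contr (\row_j series_ev (x j) z) (form_ev c z) V.
Proof.
move=> r0 rz Hx Ac Hc; rewrite (contr_basis _ (form_ev_Alt rz Ac Hc)).
have [C _ H] := form_l1_le_at V.
have Hj j : l1_le r (C * B) (fun l => contr (e_ j) (c l) V).
  by apply: (H r B (coef_contr (e_ j) c)) => //; apply: Alt_series_coef_contr.
rewrite /form_ev /field_contr (@series_ev_sum _ _ r _ _ _ (fun=> B' * (C * B))) //;
    last first.
  by move=> j; apply: l1_le_cauchy_prod.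
by apply: eq_bigr => j _; rewrite mxE (series_ev_cauchy_prod rz (Hx j) (Hj j)).
Qed.

Lemma form_evB r B B' k (c d : F k) z V : polydisc r z ->
  Alt_series c -> Alt_series d -> form_l1_le r B c -> form_l1_le r B' d ->
  form_ev (fun m V => c m V - d m V) z V = form_ev c z V - form_ev d z V.
Proof.
move=> rz Ac Ad Hc Hd.
have [C _ H] := form_l1_le_at V.
have H1 := H _ _ _ Ac Hc; have H2 := H _ _ _ Ad Hd.
rewrite /form_ev -mulN1r -(series_evZ _ rz H2) -(series_evD rz H1 (l1_leZ _ H2)).
by congr series_ev; apply/funext => m; rewrite mulN1r.
Qed.

End Families.

(** * Solving exactly from solving up to half the norm *)

Section Iteration.
Variables (R : realType) (n : nat).
Local Notation K := (Cplx R).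
Local Notation T k := ('M[K]_(k, n) -> K).
Local Notation M := {ffun 'I_n -> nat}.
Local Notation F k := (M -> T k).
Local Notation e_ j := (delta_mx 0 j : 'rV[K]_n).
Implicit Types (r z v : 'rV[K]_n) (B : K).

Lemma abssum_geometric (D : K) : 0 <= D ->
    abssum_le (D * 2) (fun q : nat => D / 2 ^+ q).
Proof.
move=> D0 A.
have [N HN] : exists N, forall q, q \in A -> (q < N)%N.
  exists (\sum_(q <- A) q).+1%N => q qA.
  by rewrite ltnS (big_fsetD1 q) //= leq_addr.
have d0 q : 0 <= D / 2 ^+ q by rewrite divr_ge0 // exprn_ge0.
apply: (@le_trans _ _ (\sum_(q <- iota 0 N) D / 2 ^+ q)).
  rewrite (eq_bigr (fun q => D / 2 ^+ q)) => [|q _]; last by rewrite ger0_norm.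
  have -> : \sum_(q <- A) D / 2 ^+ q = \sum_(q <- iota 0 N | q \in A) D / 2 ^+ q.
    rewrite -[RHS]big_filter; apply: perm_big.
    apply: uniq_perm; rewrite ?fset_uniq ?filter_uniq ?iota_uniq // => q.
    rewrite mem_filter mem_iota add0n /=.
    by have [/HN ->|] := boolP (q \in A).
  by rewrite big_mkcond; apply: ler_sum => q _; case: ifP.
suff -> : \sum_(q <- iota 0 N) D / 2 ^+ q = D * 2 - D / 2 ^+ N * 2.
  by rewrite lerBlDr lerDl mulr_ge0.
elim: N {HN} => [|N IH]; first by rewrite big_nil expr0 divr1 subrr.
rewrite -addn1 iotaD big_cat /= IH big_seq1 add0n addn1.
have -> : D / 2 ^+ N.+1 * 2 = D / 2 ^+ N by rewrite exprSr invfM mulrA divfK ?pnatr_eq0.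
by rewrite -addrA; congr (_ + _); rewrite mulr_natr mulr2n opprD subrK.
Qed.

(** The double family f q m z^m is absolutely bounded by the geometric series
    of the norms, so the order of summation is immaterial. *)
Lemma geometric_series_sum r B (f : nat -> M -> K) : pos_radii r -> 0 <= B ->
  (forall q, l1_le r (B / 2 ^+ q) (f q)) ->
  [/\ l1_le r (B * 2) (fun m => total_sum (fun q => f q m)),
      forall m, has_sum (fun q => f q m) (total_sum (fun q => f q m)) &
      forall z, polydisc r z -> has_sum (fun q => series_ev (f q) z)
          (series_ev (fun m => total_sum (fun q => f q m)) z)].
Proof.
move=> r0 B0 Hf.
have D z : polydisc r z -> dbl_abssum_le (B * 2) (fun q m => f q m * monomial m z).
  move=> rz A G; apply: le_trans (abssum_geometric B0 A); apply: ler_sum => q _.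
  apply: (@le_trans _ _ (B / 2 ^+ q)); first exact: l1_le_at rz (Hf q) G.
  by rewrite ger0_norm // divr_ge0 // exprn_ge0.
have rr := polydisc_radii r0.
have cv m : has_sum (fun q => f q m) (total_sum (fun q => f q m)).
  have Dm := dbl_abssum_row m (dbl_abssum_sym (D r rr)).
  have := abssumZ (monomial m r)^-1 Dm.
  rewrite (_ : (fun q => _) = fun q => f q m); first exact: total_sumP.
  by apply/funext => q; rewrite mulrC mulfK // gt_eqF // monomial_gt0.
have cvz m z : has_sum (fun q => f q m * monomial m z)
    (total_sum (fun q => f q m) * monomial m z).
  rewrite mulrC (_ : (fun q => _) = fun q => monomial m z * f q m);
      first exact: has_sumZ.
  by apply/funext => q; rewrite mulrC.
have gB : l1_le r (B * 2) (fun m => total_sum (fun q => f q m)).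
  exact: dbl_abssum_row_sums (dbl_abssum_sym (D r rr)) (fun m => cvz m r).
split => // z rz.
apply: (has_sum_exchange (dbl_abssum_sym (D z rz)) (fun m => cvz m z));
    last exact: series_evP rz gB.
by move=> q; apply: series_evP rz (Hf q).
Qed.

(** All the conditions are equations between values, which pass to the sum. *)
Lemma Alt_has_sum k (a : nat -> T k) (b : T k) : (forall q, Alt (a q)) ->
  (forall V, has_sum (fun q => a q V) (b V)) -> Alt b.
Proof.
elim: k a b => // k IH a b Ha Hb; split.
- move=> s t v w V; apply: (has_sum_unique (Hb _)).
  rewrite (_ : (fun q => _) = fun q => s * contr v (a q) V + t * contr w (a q) V).
    by apply: has_sumD; apply: has_sumZ; apply: Hb.
  by apply/funext => q; case: (Ha q) => l _ _; apply: l.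
- by move=> v; apply: (IH (fun q => contr v (a q))) => [q|V];
    [apply: Alt_contr | apply: Hb].
case: k {IH} a b Ha Hb => // k a b Ha Hb v V.
apply: (has_sum_unique (Hb _)).
rewrite (_ : (fun q => _) = fun=> 0); first exact: has_sum0.
by apply/funext => q; case: (Ha q) => _ _; apply.
Qed.

(** Both u and its shift are summable, and their sums differ by u 0. *)
Lemma has_sum_telescope (u : nat -> K) (D : K) : 0 <= D ->
  (forall q, `|u q| <= D / 2 ^+ q) -> has_sum (fun q => u q - u q.+1) (u 0%N).
Proof.
move=> D0 Hu.
have au : abssum_le (D * 2) u.
  apply: abssum_dominated (abssum_geometric D0) => q; apply: le_trans (Hu q) _.
  by rewrite ger0_norm // divr_ge0 // exprn_ge0.
have au' : abssum_le (D * 2) (fun q => u q.+1) by apply: abssum_inj au;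
    exact: succn_inj.
have h1 := total_sumP au; have h2 := total_sumP au'.
pose w q : K := if q is q'.+1 then u q else 0.
have h3 : has_sum (fun q => (q == 0%N)%:R * u 0%N + w q)
    (u 0%N + total_sum (fun q => u q.+1)).
  apply: has_sumD.
    have := @has_sum_fin R nat (fun q => (q == 0%N)%:R * u 0%N) [fset 0%N].
    rewrite big_seq_fset1 eqxx !mul1r; apply=> q; rewrite in_fset1 => /negbTE ->.
    by rewrite mul0r.
  by apply: (@has_sum_can R nat nat succn predn w) => // -[|q] //=; rewrite eqxx.
have E : (fun q => (q == 0%N)%:R * u 0%N + w q) = u.
  by apply/funext => -[|q]; rewrite /w ?eqxx ?mul1r ?addr0 //= mul0r add0r.
rewrite E in h3.
have -> : u 0%N = total_sum u + -1 * total_sum (fun q => u q.+1).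
  by rewrite (has_sum_unique h1 h3) mulN1r addrK.
rewrite (_ : (fun q => _) = fun q => u q + -1 * u q.+1); last first.
  by apply/funext => q; rewrite mulN1r.
by apply: has_sumD => //; apply: has_sumZ.
Qed.

Lemma field_contr_eq0 r (x : 'I_n -> M -> K) B B' k (c : F k.+1) : pos_radii r ->
  (forall j, l1_le r B' (x j)) -> Alt_series c -> form_l1_le r B c ->
  (forall z V, polydisc r z -> contr (\row_j series_ev (x j) z) (form_ev c z) V =
      0) ->
  forall m V, field_contr x c m V = 0.
Proof.
move=> r0 Hx Ac Hc H m V.
have [C _ HC] := form_l1_le_at V.
have HV := HC _ _ _ (field_contr_Alt x Ac) (form_l1_le_field_contr r0 Hx Hc).
apply: (series_ev_eq0 r0 HV ltr01 (c := fun m => field_contr x c m V)) => z rz _.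
by have := H z V rz; rewrite -(form_ev_field_contr V r0 rz Hx Ac Hc).
Qed.

Lemma form_ev_contr_eq0 r (x : 'I_n -> M -> K) B B' k (c : F k.+1) : pos_radii r ->
  (forall j, l1_le r B' (x j)) -> Alt_series c -> form_l1_le r B c ->
  (forall m V, field_contr x c m V = 0) ->
  forall z V, polydisc r z -> contr (\row_j series_ev (x j) z) (form_ev c z) V = 0.
Proof.
move=> r0 Hx Ac Hc H z V rz; rewrite -(form_ev_field_contr V r0 rz Hx Ac Hc)
    /form_ev.
apply: total_sumE; rewrite (_ : (fun m => _) = fun=> 0); first exact: has_sum0.
by apply/funext => m; rewrite H mul0r.
Qed.

Lemma Alt_series_sub k (c d : F k) : Alt_series c -> Alt_series d ->
    Alt_series (fun m V => c m V - d m V).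
Proof.
move=> Ac Ad m; have := Alt_comb 1 (-1) (Ac m) (Ad m).
by under eq_fun do rewrite mul1r mulN1r.
Qed.

(** Replace c by the remainder c - i_x (H c) over and over.  Remainders are
    still annihilated by i_x, since i_x is of square zero on functions and a
    series is determined by its function; their norms halve at each stage.
    The forms H c_q sum to a form b, and i_X b telescopes to c. *)
Lemma solve_by_iteration r (x : 'I_n -> M -> K) Bx k (H : F k.+1 -> F k.+2) (C : K)
    :
  pos_radii r -> (forall j, l1_le r Bx (x j)) -> 0 <= C ->
  (forall c B, 0 <= B -> Alt_series c -> form_l1_le r B c ->
      (forall m V, field_contr x c m V = 0) ->
     [/\ Alt_series (H c), form_l1_le r (C * B) (H c) & form_l1_le r (B / 2)
         (fun m V => c m V - field_contr x (H c) m V)]) ->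
  forall c B, 0 <= B -> Alt_series c -> form_l1_le r B c ->
      (forall m V, field_contr x c m V = 0) ->
  exists b : F k.+2, exists B', [/\ Alt_series b, form_l1_le r B' b &
    forall z V, polydisc r z -> form_ev c z V =
        contr (\row_j series_ev (x j) z) (form_ev b z) V].
Proof.
move=> r0 Hx C0 step c B B0 Ac Hc Xc.
pose cq q : F k.+1 := iter q (fun d m V => d m V - field_contr x (H d) m V) c.
have inv q : [/\ Alt_series (cq q), form_l1_le r (B / 2 ^+ q) (cq q) & forall m V,
    field_contr x (cq q) m V = 0].
  elim: q => [|q [A1 A2 A3]]; first by rewrite expr0 divr1.
  have Bq0 : 0 <= B / 2 ^+ q by rewrite divr_ge0 // exprn_ge0.
  have [S1 S2 S3] := step _ _ Bq0 A1 A2 A3.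
  have A4 : Alt_series (cq q.+1) by apply: Alt_series_sub => //;
      apply: field_contr_Alt.
  have A5 : form_l1_le r (B / 2 ^+ q.+1) (cq q.+1) by rewrite exprSr invfM mulrA.
  split => //.
  apply: (field_contr_eq0 r0 Hx A4 A5) => z V rz.
  have S4 := form_l1_le_field_contr r0 Hx S2.
  rewrite [LHS](form_evB _ rz A1 (field_contr_Alt x S1) A2 S4).
  have -> : form_ev (cq q) z (col_mx (\row_j series_ev (x j) z) V) = 0.
    exact: (form_ev_contr_eq0 r0 Hx A1 A2 A3).
  rewrite (form_ev_field_contr _ r0 rz Hx S1 S2) sub0r.
  by case: (form_ev_Alt rz S1 S2) => _ _ d0; rewrite [X in - X]d0 oppr0.
have Bq0 q : 0 <= B / 2 ^+ q by rewrite divr_ge0 // exprn_ge0.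
have SA q : Alt_series (H (cq q)) by case: (inv q) => a1 a2 a3;
    case: (step _ _ (Bq0 q) a1 a2 a3).
have SB q : form_l1_le r (C * B / 2 ^+ q) (H (cq q)).
  by case: (inv q) => a1 a2 a3; case: (step _ _ (Bq0 q) a1 a2 a3); rewrite mulrA.
have CB0 : 0 <= C * B by rewrite mulr_ge0.
have HVq (V : 'M[K]_(k.+2, n)) : exists2 D, 0 <= D & forall q,
    l1_le r (D / 2 ^+ q) (fun m => H (cq q) m V).
  have [CV CV0 HV] := form_l1_le_at V.
  exists (CV * (C * B)); first by rewrite mulr_ge0.
  by move=> q; have := HV _ _ _ (SA q) (SB q); rewrite !mulrA.
pose b : F k.+2 := fun m V => total_sum (fun q => H (cq q) m V).
have bA : Alt_series b.
  move=> m; apply: (Alt_has_sum (fun q => SA q m)) => V.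
  have [D D0 HD] := HVq V.
  by have [_ h _] := geometric_series_sum r0 D0 HD; apply: h.
have bB : form_l1_le r (C * B * 2) b.
  apply: (@form_l1_le_map R n nat r r _ (fun q => C * B / 2 ^+ q)
      (fun f m => total_sum (fun q => f q m)) _
    (fun q => H (cq q))) => // f Hf.
  by have [] := geometric_series_sum r0 CB0 Hf.
exists b, (C * B * 2); split=> // z V rz.
rewrite (contr_basis _ (form_ev_Alt rz bA bB)).
have [CV CV0 HV] := form_l1_le_at V.
have tel : has_sum (fun q => form_ev (cq q) z V - form_ev (cq q.+1) z V)
    (form_ev c z V).
  apply: (@has_sum_telescope (fun q => form_ev (cq q) z V) (CV * B));
      first by rewrite mulr_ge0.
  move=> q; have [a1 a2 a3] := inv q; rewrite -mulrA.
  by apply: series_ev_norm_le rz (HV _ _ _ a1 a2).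
apply: (has_sum_unique tel).
rewrite (_ : (fun q => _) = fun q => \sum_j (\row_j series_ev (x j) z) 0 j *
    contr (e_ j) (form_ev (H (cq q)) z) V).
  apply: has_sum_sum => j; apply: has_sumZ.
  have [D D0 HD] := HVq (col_mx (e_ j) V : 'M_(k.+2, n)).
  by have [_ _ h] := geometric_series_sum r0 D0 HD; apply: h.
apply/funext => q; have [a1 a2 a3] := inv q.
rewrite (form_evB _ rz a1 (field_contr_Alt x (SA q)) a2
    (form_l1_le_field_contr r0 Hx (SB q))).
rewrite opprB addrC subrK (form_ev_field_contr _ r0 rz Hx (SA q) (SB q)).
by rewrite (contr_basis _ (form_ev_Alt rz (SA q) (SB q))).
Qed.

End Iteration.

(** * Contracting homotopies and their perturbation *)

Section Homotopy.
Variables (R : realType) (n : nat).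
Local Notation K := (Cplx R).
Local Notation T k := ('M[K]_(k, n) -> K).
Local Notation M := {ffun 'I_n -> nat}.
Local Notation F k := (M -> T k).
Local Notation e_ j := (delta_mx 0 j : 'rV[K]_n).
Implicit Types (r z v : 'rV[K]_n) (B : K).

(** Exactness of the Koszul complex of x in degree k + 1, witnessed by
    operators H that contract it. *)
Definition homotopy (x : 'I_n -> M -> K) k (H : forall k, F k -> F k.+1) : Prop :=
  forall c : F k.+1, Alt_series c -> forall m V, field_contr x (H _ c) m V +
      H _ (field_contr x c) m V = c m V.

Definition bounded_op r (C : K) k (H : F k -> F k.+1) : Prop :=
  forall c, Alt_series c -> Alt_series (H c) /\ forall B, 0 <= B ->
      form_l1_le r B c -> form_l1_le r (C * B) (H c).

(** When i_x c = 0 the homotopy formula gives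
      c - i_x (H c) = H (i_x0 c) - i_N (H c) = - H (i_N c) - i_N (H c),
    and this is at most half of c in norm if N is small compared with the
    inverse of the norm of H. *)
Lemma solve_by_perturbation r (x x0 N : 'I_n -> M -> K) (Bx eta C : K) k
    (H : forall k, F k -> F k.+1) :
  pos_radii r -> (forall j, l1_le r Bx (x j)) -> (forall j, l1_le r eta (N j)) ->
  (forall j l, x j l = x0 j l + N j l) ->
  0 <= C -> 0 <= eta -> n%:R * eta * C * 4 <= 1 ->
  homotopy x0 k H -> bounded_op r C (H k) -> bounded_op r C (H k.+1) ->
  forall (c : F k.+1) B, 0 <= B -> Alt_series c -> form_l1_le r B c ->
      (forall m V, field_contr x c m V = 0) ->
  exists b : F k.+2, exists B', [/\ Alt_series b, form_l1_le r B' b &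
    forall z V, polydisc r z -> form_ev c z V =
        contr (\row_j series_ev (x j) z) (form_ev b z) V].
Proof.
move=> r0 Hx HN xE C0 eta0 small hom H1 H2.
have ixE k' (c : F k'.+1) m V : field_contr x c m V = field_contr x0 c m V +
    field_contr N c m V.
  rewrite -field_contrD; apply: eq_bigr => j _; congr (cauchy_prod _ _ _).
  by apply/funext => l; apply: xE.
apply: (solve_by_iteration r0 Hx C0) => c B B0 Ac Hc Xc.
have [A1 /(_ _ B0 Hc) B1] := H2 c Ac.
split => //.
have ANc : Alt_series (field_contr x0 c) by apply: field_contr_Alt.
have BNc : form_l1_le r (n%:R * eta * B) (field_contr x0 c).
  rewrite (_ : field_contr x0 c = fun m V => - field_contr N c m V);
      first exact: form_l1_leN (form_l1_le_field_contr r0 HN Hc).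
  apply/funext => m; apply/funext => V; apply/eqP; rewrite -addr_eq0 -ixE.
  by rewrite Xc.
have B2 : form_l1_le r (C * (n%:R * eta * B)) (H k (field_contr x0 c)).
  by have [_] := H1 _ ANc; apply=> //; rewrite !mulr_ge0.
have B3 := form_l1_le_field_contr r0 HN B1.
have := form_l1_leD B2 (form_l1_leN B3).
rewrite (_ : (fun m V => _) = fun m V => c m V - field_contr x (H _ c) m V).
  apply: form_l1_le_trans; rewrite ler_pdivlMr //.
  have -> : (C * (n%:R * eta * B) + n%:R * eta * (C * B)) * 2 = n%:R * eta * C * 4 *
      B by ring.
  by rewrite ler_piMl.
apply/funext => m; apply/funext => V.
rewrite ixE opprD addrA; congr (_ - _).
by rewrite -(hom c Ac m V) [X in X - _]addrC addrK.
Qed.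

Lemma field_contr_const (v : 'rV[K]_n) k (c : F k.+1) : Alt_series c ->
  field_contr (fun j l => v 0 j * (l == mzero n)%:R) c = fun m => contr v (c m).
Proof.
move=> Ac; apply/funext => m; apply/funext => V; rewrite contr_basis //.
by apply: eq_bigr => j _; rewrite cauchy_prod_mzero.
Qed.

(** For a nonzero constant field the exterior product with a covector of value
    1 on it contracts the Koszul complex. *)
Lemma homotopy_const (v : 'rV[K]_n) (th : 'cV[K]_n) k : covec th v = 1 ->
  homotopy (fun j l => v 0 j * (l == mzero n)%:R) k (fun _ c m => wedge th (c m)).
Proof.
move=> tv c Ac m V; rewrite !field_contr_const //; last by move=> l;
    apply: Alt_wedge.
by rewrite contr_wedge tv mul1r subrK.
Qed.

Lemma norm_bound_fin (I : finType) (f : I -> K) : exists2 U, 0 <= U & forall i,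
    `|f i| <= U.
Proof.
exists (\sum_i `|f i|) => [|i]; first exact: sumr_ge0.
by rewrite (bigD1 i) //= lerDl sumr_ge0.
Qed.

Lemma bounded_wedge r (th : 'cV[K]_n) (U : K) k : (forall j, `|th j 0| <= U) ->
  bounded_op r (k.+1%:R * U) (fun (c : F k) m => wedge th (c m)).
Proof.
move=> HU c Ac; split=> [m|B B0 Hc]; first exact: Alt_wedge.
exact: form_l1_le_wedge.
Qed.

Section Linear.
Variables (q : nat) (u : 'M[K]_(q, n)) (th : 'I_q -> 'cV[K]_n) (s : 'I_q -> 'I_n).
Hypothesis s_inj : injective s.
Hypothesis dual : forall a b, covec (th a) (row b u) = (a == b)%:R.

(** The linear field with value the sum over a of z_(s a) times the a-th row
    of u. *)
Definition lin_series (j : 'I_n) (l : M) : K := \sum_a u a j *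
    (l == munit (s a))%:R.

Lemma field_contr_lin k (c : F k.+1) m V : Alt_series c ->
  field_contr lin_series c m V = \sum_a mul_coord (s a)
      (fun l => contr (row a u) (c l) V) m.
Proof.
move=> Ac.
transitivity (\sum_j \sum_a u a j *
    mul_coord (s a) (fun l => contr (e_ j) (c l) V) m).
  apply: eq_bigr => j _.
  transitivity (\sum_a cauchy_prod (fun l => u a j * (l == munit (s a))%:R)
      (fun l => contr (e_ j) (c l) V) m).
    rewrite /cauchy_prod exchange_big; apply: eq_bigr => l _; rewrite mulr_suml //.
  by apply: eq_bigr => a _; rewrite cauchy_prod_munit.
rewrite exchange_big; apply: eq_bigr => a _; rewrite /mul_coord; case: ifP => _.
  rewrite (contr_basis (row a u)) //.
  by apply: eq_bigr => j _; rewrite mxE.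
by rewrite big1 // => j _; rewrite mulr0.
Qed.

(** Divide the coefficients by the coordinate z_(s a), then multiply by the
    covector th a: a homotopy for one factor of the Koszul complex. *)
Definition div_wedge a k (c : F k) : F k.+1 := fun m =>
    wedge (th a) (c (madd (munit (s a)) m)).

(** The projection left over by [div_wedge]: restrict to z_(s a) = 0 and drop
    the terms that contain th a. *)
Definition cut_wedge a k (c : F k) : F k :=
  fun m V => if m (s a) == 0%N then contr (row a u) (wedge (th a) (c m)) V else 0.

Lemma div_wedge_Alt a k (c : F k) : Alt_series c -> Alt_series (div_wedge a c).
Proof. by move=> Ac m; apply: Alt_wedge. Qed.

Lemma cut_wedge_Alt a k (c : F k) : Alt_series c -> Alt_series (cut_wedge a c).
Proof.
move=> Ac m; rewrite /cut_wedge; case: (m (s a) == 0%N); last exact: Alt_zero.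
by apply: Alt_contr; apply: Alt_wedge.
Qed.

Lemma madd_msub_comm a b (m : M) : a != b -> (0 < m (s b))%N ->
  msub (madd (munit (s a)) m) (munit (s b)) =
      madd (munit (s a)) (msub m (munit (s b))).
Proof.
move=> ab mb; apply/ffunP => i; rewrite !ffunE.
case: (i =P s b) => [->|_]; last by rewrite !subn0.
by rewrite (inj_eq s_inj) eq_sym (negbTE ab) !add0n.
Qed.

(** Distinct indices anticommute, so only the summand of the index a of the
    field contributes.  There, dividing z_(s a) f by z_(s a) returns f, and
    multiplying the quotient by z_(s a) returns f less its restriction to
    z_(s a) = 0. *)
Lemma div_wedge_homotopy a k (c : F k.+1) m V : Alt_series c ->
  field_contr lin_series (div_wedge a c) m V +
      div_wedge a (field_contr lin_series c) m V = c m V - cut_wedge a c m V.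
Proof.
move=> Ac; rewrite field_contr_lin; last exact: div_wedge_Alt.
have -> : div_wedge a (field_contr lin_series c) m V = \sum_b
  mul_coord (s b) (fun l => wedge (th a) (contr (row b u) (c l)) V)
      (madd (munit (s a)) m).
  rewrite /div_wedge (_ : field_contr _ _ _ = fun V =>
      \sum_b mul_coord (s b) (fun l => contr (row b u) (c l) V)
    (madd (munit (s a)) m)); last by apply/funext => W; apply: field_contr_lin.
  rewrite wedge_sum; apply: eq_bigr => b _.
  by rewrite /mul_coord; case: ifP => _ //; rewrite wedge_zero.
rewrite -big_split /= (bigD1 a) //= [X in _ + X]big1 ?addr0 => [|b ba]; last first.
  rewrite /mul_coord !ffunE (inj_eq s_inj) (negbTE ba) add0n.
  case: ifP => mb; last by rewrite addr0.
  rewrite madd_msub_comm // 1?eq_sym // /div_wedge contr_wedge dual eq_sym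
      (negbTE ba) mul0r sub0r.
  by rewrite addNr.
rewrite /mul_coord /cut_wedge !ffunE eqxx add1n ltn0Sn maddK /div_wedge lt0n.
rewrite !contr_wedge dual eqxx !mul1r.
case: eqP => /= m0.
  by rewrite add0r opprB addrC subrK.
have -> : madd (munit (s a)) (msub m (munit (s a))) = m.
  by apply/eqP; rewrite msubKE mle_munit lt0n; apply/eqP.
by rewrite subrK subr0.
Qed.

(** The summand of index a is zero on both sides: the restriction kills the
    coordinate z_(s a), and the projected form has no component along th a.  The
    other summands commute with the projection. *)
Lemma cut_wedge_field_contr a k (c : F k.+1) : Alt_series c ->
    cut_wedge a (field_contr lin_series c) = field_contr lin_series (cut_wedge a c).
Proof.
move=> Ac; apply/funext => m; apply/funext => V;
    rewrite (field_contr_lin _ _ (cut_wedge_Alt a Ac)).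
rewrite /cut_wedge (_ : field_contr _ _ _ = fun V =>
    \sum_b mul_coord (s b) (fun l => contr (row b u) (c l) V) m);
  last by apply/funext => W; apply: field_contr_lin.
rewrite wedge_sum.
transitivity (\sum_b (if m (s a) == 0%N then contr (row a u) (wedge (th a)
    (fun W => mul_coord (s b) (fun l => contr (row b u) (c l) W) m)) V else 0)).
  by case: (m (s a) == 0%N) => //; rewrite big1.
apply: eq_bigr => b _; rewrite /mul_coord !ffunE.
case: (boolP (m (s a) == 0%N)) => ma; case: (boolP (0 < m (s b))%N) => mb.
- have ab : a != b by apply: contraTneq mb => <-; rewrite (eqP ma).
  rewrite (inj_eq s_inj) (negbTE ab) subn0 ma.
  have Aw := Alt_wedge (th a) (Ac (msub m (munit (s b)))).
  rewrite [RHS](congr1 (fun f => f V) (contrC (row b u) (row a u) Aw)).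
  rewrite contr_wedge dual (negbTE ab).
  rewrite (_ : (fun V0 => 0 * _ V0 - _ V0) = fun W => -1 *
      wedge (th a) (contr (row b u) (c (msub m (munit (s b))))) W + 0 * 0);
      last first.
    by apply/funext => W; rewrite mulN1r mul0r mul0r add0r addr0.
  by rewrite /contr mulN1r mul0r addr0 opprK.
- by rewrite wedge_zero.
- have [ab|ab] := eqVneq a b; last first.
    by rewrite (inj_eq s_inj) (negbTE ab) subn0 (negbTE ma).
  subst b; set bb := (_ == 0%N); case: bb => //.
  by case: (Alt_wedge (th a) (Ac (msub m (munit (s a))))) => _ _ ->.
- by [].
Qed.

(** The Koszul complex is a tensor product of complexes of length one; the
    homotopies of the factors are combined by applying the one of each factor
    after the projections of the factors before it. *)
Fixpoint koszul_homotopy (l : seq 'I_q) k (c : F k) : F k.+1 :=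
  if l is a :: l' then fun m V => div_wedge a c m V +
      koszul_homotopy l' (cut_wedge a c) m V else fun _ _ => 0.

Fixpoint koszul_proj (l : seq 'I_q) k (c : F k) : F k :=
  if l is a :: l' then koszul_proj l' (cut_wedge a c) else c.

Lemma koszul_homotopy_Alt l k (c : F k) : Alt_series c ->
    Alt_series (koszul_homotopy l c).
Proof.
elim: l c => [|a l IH] c Ac m; first exact: Alt_zero.
exact: Alt_add (div_wedge_Alt a Ac m) (IH _ (cut_wedge_Alt a Ac) m).
Qed.

Lemma koszul_proj_Alt l k (c : F k) : Alt_series c -> Alt_series (koszul_proj l c).
Proof. by elim: l c => [|a l IH] c Ac //=; apply: IH; apply: cut_wedge_Alt. Qed.

Lemma koszul_homotopyP l k (c : F k.+1) m V : Alt_series c ->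
  field_contr lin_series (koszul_homotopy l c) m V +
      koszul_homotopy l (field_contr lin_series c) m V =
      c m V - koszul_proj l c m V.
Proof.
elim: l c => [|a l IH] c Ac /=.
  rewrite addr0 subrr /field_contr big1 // => j _.
  by rewrite /cauchy_prod big1 // => i _; rewrite /contr mulr0.
have -> : field_contr lin_series (fun m V => div_wedge a c m V +
    koszul_homotopy l (cut_wedge a c) m V) m V =
    field_contr lin_series (div_wedge a c) m V +
        field_contr lin_series (koszul_homotopy l (cut_wedge a c)) m V.
  rewrite /field_contr -big_split; apply: eq_bigr => j _ /=.
  by rewrite /cauchy_prod -big_split; apply: eq_bigr => i _; rewrite /contr mulrDr.
rewrite addrACA div_wedge_homotopy // cut_wedge_field_contr // IH;
    last exact: cut_wedge_Alt.
by rewrite addrA subrK.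
Qed.

(** Once the factor of index a has been projected, the interior product with
    its vector vanishes, and the later projections keep this. *)
Lemma koszul_proj_killed l k (c : F k.+1) a : Alt_series c ->
  (a \in l \/ forall m, contr (row a u) (c m) = fun=> 0) ->
  forall m, contr (row a u) (koszul_proj l c m) = fun=> 0.
Proof.
elim: l c => [|b l IH] c Ac; first by case.
move=> H; apply: IH; first exact: cut_wedge_Alt.
rewrite in_cons in H.
have [ab|ab] := eqVneq a b.
  right => m; apply/funext => V; rewrite /cut_wedge /contr; case: ifP => // _.
  subst b; have := Alt_wedge (th a) (Ac m).
  by case=> _ _; apply.
rewrite (negbTE ab) /= in H.
case: H => [|Hc]; [by left | right => m].
apply/funext => V; rewrite /cut_wedge /contr; case: ifP => // _.
rewrite -/(contr (row b u) _ _) -/(contr (row a u) _ _).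
rewrite [LHS](congr1 (fun f => f V)
    (contrC (row a u) (row b u) (Alt_wedge (th b) (Ac m)))).
rewrite contr_wedge dual Hc wedge_zero eq_sym (negbTE ab).
by rewrite /contr mul0r subr0 oppr0.
Qed.

Hypothesis u_free : row_free u.

(** A form annihilated by the q independent rows of u vanishes when its degree
    exceeds n - q. *)
Lemma koszul_proj_eq0 k (c : F k.+1) m V : Alt_series c -> (n < q + k.+1)%N ->
    koszul_proj (enum 'I_q) c m V = 0.
Proof.
move=> Ac lt; apply: (Alt_vanish _ u_free lt) => [|j]; first exact: koszul_proj_Alt.
by apply: koszul_proj_killed => //; left; rewrite mem_enum.
Qed.

Lemma homotopy_linear k : (n < q + k.+1)%N ->
  homotopy lin_series k (fun k => @koszul_homotopy (enum 'I_q) k).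
Proof. by move=> lt c Ac m V; rewrite koszul_homotopyP // koszul_proj_eq0 // subr0.
    Qed.

(** Each term of the homotopy divides by exactly one coordinate, which costs
    1 / t; all other operations are bounded independently of the radii. *)
Lemma bounded_koszul_homotopy l k : exists2 C : K, 0 <= C & forall r (t : K),
    pos_radii r -> 0 < t ->
  (forall a, t <= r 0 (s a)) -> bounded_op r (C / t) (@koszul_homotopy l k).
Proof.
have [U U0 HU] := norm_bound_fin (fun p : 'I_q * 'I_n => th p.1 p.2 0).
have [W W0 HW] := norm_bound_fin (fun p : 'I_q => \sum_j `|u p j|).
have HWp a : \sum_j `|row a u 0 j| <= W.
  apply: le_trans (HW a); rewrite ger0_norm ?sumr_ge0 //.
  by apply: ler_sum => j _; rewrite mxE.
pose w := k.+1%:R * U.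
have w0 : 0 <= w by rewrite mulr_ge0.
have Bpj a r B (c : F k) : Alt_series c -> 0 <= B -> form_l1_le r B c ->
    form_l1_le r (W * w * B) (cut_wedge a c).
  move=> Ac B0 Hc.
  have B1 : form_l1_le r (w * B) (fun m => wedge (th a) (c m)).
    by apply: form_l1_le_wedge => // j; apply: (HU (a, j)).
  have B2 := form_l1_le_contr (row a u) (fun m => Alt_wedge (th a) (Ac m)) B1.
  apply: (@form_l1_le_map1 R n r r (W * w * B) _ (cut_coord (s a)) k
      (fun m => contr (row a u) (wedge (th a) (c m)))).
    by move=> f; apply: l1_le_cut_coord.
  by apply: form_l1_le_trans B2; rewrite -mulrA; apply: ler_wpM2r;
      rewrite ?mulr_ge0.
elim: l => [|a l [C C0 IH]].
  exists 0 => // r t r0 t0 _ c Ac; split; first by move=> m; apply: Alt_zero.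
  by move=> B B0 _; rewrite !mul0r; apply: form_l1_le0.
exists (w + C * (W * w)); first by rewrite addr_ge0 // !mulr_ge0.
move=> r t r0 t0 rt c Ac; split; first exact: koszul_homotopy_Alt.
move=> B B0 Hc.
have -> : (w + C * (W * w)) / t * B = w * (B / t) + C / t * (W * w * B) by ring.
apply: form_l1_leD; last first.
  have [_] := IH r t r0 t0 rt (cut_wedge a c) (cut_wedge_Alt a Ac).
  by apply; [rewrite !mulr_ge0 | apply: Bpj].
apply: (@form_l1_le_wedge R n r (B / t) U (th a) k
    (fun m => c (madd (munit (s a)) m))).
- by rewrite divr_ge0 // ltW.
- by move=> j; apply: (HU (a, j)).
apply: (@form_l1_le_map1 R n r r B _ (div_coord (s a)) k c) Hc =>
    f /(l1_le_div_coord (s a) r0).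
by apply: abssum_weak; apply: ler_wpM2l => //; rewrite lef_pV2 ?posrE.
Qed.

End Linear.
End Homotopy.

(** * Series representing germs of forms and of vector fields *)

Section Representation.
Variables (R : realType) (n : nat).
Local Notation K := (Cplx R).
Local Notation T k := ('M[K]_(k, n) -> K).
Local Notation M := {ffun 'I_n -> nat}.
Local Notation F k := (M -> T k).
Local Notation e_ j := (delta_mx 0 j : 'rV[K]_n).
Implicit Types (r z v : 'rV[K]_n) (B : K).

Lemma near_polydisc r : pos_radii r -> \forall z \near (0 : 'rV[K]_n), polydisc r z.
Proof.
move=> /pos_lower_bound[e e0 He]; apply/nbhs_rowP; exists e => // z Hz i.
by apply: le_trans (He i); have := Hz i; rewrite mxE subr0.
Qed.

Definition has_series (f : 'rV[K]_n -> K) (c : M -> K) : Prop :=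
  exists t B, [/\ 0 < t, l1_le (const_mx t) B c &
    forall z, polydisc (const_mx t) z -> f z = series_ev c z].

Lemma polydisc_const (s t : K) : 0 < s -> s <= t ->
  polydisc (const_mx t) (const_mx s : 'rV[K]_n).
Proof. by move=> s0 st i; rewrite !mxE ger0_norm // ltW. Qed.

Lemma polydisc_le r r' z : polydisc r r' -> pos_radii r' -> polydisc r' z ->
    polydisc r z.
Proof.
move=> rr r0 rz i; apply: le_trans (rz i) _; apply: le_trans (rr i).
by rewrite ger0_norm // ltW.
Qed.

Lemma has_series_comb f g c d (x y : K) : has_series f c -> has_series g d ->
  has_series (fun z => x * f z + y * g z) (fun m => x * c m + y * d m).
Proof.
move=> [t1 [B1 [t10 H1 E1]]] [t2 [B2 [t20 H2 E2]]].
have [t [t0 tt1 tt2]] := pos_lower_bound2 t10 t20.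
have p1 := polydisc_const t0 tt1; have p2 := polydisc_const t0 tt2.
have H1' := l1_le_sub p1 H1; have H2' := l1_le_sub p2 H2.
exists t, (`|x| * B1 + `|y| * B2); split=> //; first by apply: l1_leD;
    apply: l1_leZ.
move=> z tz; rewrite (series_evD tz (l1_leZ x H1') (l1_leZ y H2'))
    (series_evZ _ tz H1') (series_evZ _ tz H2').
have r0 := @const_radii R n _ t0.
by rewrite E1 ?E2 //; apply: polydisc_le tz.
Qed.

Lemma has_series0 : has_series (fun=> 0) (fun=> 0).
Proof.
exists 1, 0; split=> //.
  by apply: (abssum_dominated _ (@abssum0 R _)) => m; rewrite mul0r.
move=> z _; rewrite /series_ev; apply/esym/total_sumE.
by under eq_fun do rewrite mul0r; apply: has_sum0.
Qed.

Lemma has_series_uniq f g c d : has_series f c -> has_series g d ->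
  (\forall z \near (0 : 'rV[K]_n), f z = g z) -> c = d.
Proof.
move=> [t1 [B1 [t10 H1 E1]]] [t2 [B2 [t20 H2 E2]]] /nbhs_rowP[e e0 He].
have [t [t0 tt1 tt2]] := pos_lower_bound2 t10 t20.
have p1 := polydisc_const t0 tt1; have p2 := polydisc_const t0 tt2.
have H1' := l1_le_sub p1 H1; have H2' := l1_le_sub p2 H2.
have r0 := @const_radii R n _ t0.
apply: (series_ev_inj r0 H1' H2' e0) => z tz ez.
rewrite -E1 -?E2; try exact: polydisc_le tz.
by apply: He => i; rewrite mxE subr0.
Qed.

(** Finitely many tuples of basis vectors occur, so radii that depend on the
    tuple have a common lower bound. *)
Lemma form_l1_le_exists k (c : F k) :
  (forall V, exists t B, 0 < t /\ l1_le (const_mx t) B (fun m => c m V)) ->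
  exists t B, [/\ 0 < t, 0 <= B & form_l1_le (const_mx t) B c].
Proof.
elim: k c => [|k IH] c H.
  by have [t [B [t0 HB]]] := H 0; exists t, B; split=> //; apply: abssum_ge0 HB.
have Hj (j : 'I_n) : exists tB : K * K,
    [/\ 0 < tB.1, 0 <= tB.2 & form_l1_le (const_mx tB.1) tB.2
    (coef_contr (e_ j) c)].
  by have [|t [B ?]] := IH (coef_contr (e_ j) c);
      [move=> V; apply: H | exists (t, B)].
have [tB HtB] := choice Hj.
have [t t0 Ht] := @pos_lower_bound R _ (fun j => (tB j).1)
    (fun j => let: And3 h _ _ := HtB j in h).
exists t, (\sum_j (tB j).2); split=> //; first by apply: sumr_ge0 => j _;
    case: (HtB j).
move=> j; have [tj Bj Hb] := HtB j.
apply: form_l1_le_weak Hb; first exact: polydisc_const.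
by rewrite (bigD1 j) //= lerDl sumr_ge0 // => i _; case: (HtB i).
Qed.

(** By multilinearity it is enough to intersect the neighbourhoods of the
    finitely many tuples of basis vectors. *)
Lemma near_forall_covectors k (a b : 'rV[K]_n -> T k) :
  (\forall z \near (0 : 'rV[K]_n), Alt (a z) /\ Alt (b z)) ->
  (forall V, \forall z \near (0 : 'rV[K]_n), a z V = b z V) ->
  \forall z \near (0 : 'rV[K]_n), forall V, a z V = b z V.
Proof.
elim: k a b => [|k IH] a b HA H.
  apply: filterS (H 0) => z Hz V; rewrite (_ : V = 0) //.
  by apply/matrixP => -[].
have Hj : forall j : 'I_n, \forall z \near (0 : 'rV[K]_n), forall V,
    contr (e_ j) (a z) V = contr (e_ j) (b z) V.
  move=> j; apply: IH => [|V]; last exact: H.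
  by apply: filterS HA => z [Ha Hb]; split; apply: Alt_contr.
have := filter_forall _ Hj.
move=> /(_ _) Hj'.
apply: filterS2 HA Hj' => z [Ha Hb] Hz V.
rewrite !contr_eval !(contr_basis _ Ha) !(contr_basis _ Hb).
by apply: eq_bigr => j _; rewrite Hz.
Qed.

(** Choose a series for each value a z V; by uniqueness of the series its
    coefficients are multilinear and alternating in V. *)
Lemma form_series k (a : Defs.form R n k) : holomorphic_form a ->
  exists c t B, [/\ Alt_series c, 0 < t, 0 <= B, form_l1_le (const_mx t) B c &
    \forall z \near (0 : 'rV[K]_n), forall V, a z V = form_ev (c : F k) z V].
Proof.
move=> [HA Hh].
have HV V : exists c, has_series (fun z => a z V) c.
  by have [t [B [c ?]]] := holomorphic_series_ev (Hh V); exists c, t, B.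
have [c0 Hc0] := choice HV.
pose c : F k := fun m V => c0 V m.
have Ac : Alt_series c.
  move=> m; apply/AltP; split.
    move=> U V W i x y HU HV1 HW; rewrite /c.
    suff -> : c0 U = fun m => x * c0 V m + y * c0 W m by [].
    apply: (has_series_uniq (Hc0 U) (has_series_comb x y (Hc0 V) (Hc0 W))).
    by apply: filterS HA => z [ml _]; apply: ml HU HV1 HW.
  move=> V i j ij E; rewrite /c.
  suff -> : c0 V = fun=> 0 by [].
  apply: (has_series_uniq (Hc0 V) has_series0).
  by apply: filterS HA => z [_ al]; apply: al ij E.
have [|t [B [t0 B0 Hb]]] := @form_l1_le_exists _ c.
  by move=> V; have [t [B [t0 HB _]]] := Hc0 V; exists t, B.
exists c, t, B; split=> //.
have r0 := @const_radii R n _ t0.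
apply: near_forall_covectors.
  apply: filterS2 HA (near_polydisc r0) => z [ml al] tz; split; first by apply/AltP.
  exact: form_ev_Alt tz Ac Hb.
move=> V; have [tV [BV [tV0 HBV EV]]] := Hc0 V.
by apply: filterS (near_polydisc (@const_radii R n _ tV0)) => z /EV.
Qed.

Lemma vector_series (X : 'rV[K]_n -> 'rV[K]_n) : holomorphic_vector_field X ->
  exists x t B, [/\ 0 < t, 0 <= B, forall j, l1_le (const_mx t) B (x j) &
    forall z, polydisc (const_mx t) z -> X z = \row_j series_ev (x j) z].
Proof.
move=> HX.
have Hj (j : 'I_n) : exists tBc : K * K * (M -> K), [/\ 0 < tBc.1.1,
    l1_le (const_mx tBc.1.1) tBc.1.2 tBc.2 &
    forall z, polydisc (const_mx tBc.1.1) z -> X z 0 j = series_ev tBc.2 z].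
  by have [t [B [c ?]]] := holomorphic_series_ev (HX j); exists (t, B, c).
have [y Hy] := choice Hj.
have [t t0 Ht] := @pos_lower_bound R _ (fun j => (y j).1.1)
    (fun j => let: And3 h _ _ := Hy j in h).
have B0 j : 0 <= (y j).1.2 by case: (Hy j) => _ /abssum_ge0.
exists (fun j => (y j).2), t, (\sum_j (y j).1.2); split=> //.
- exact: sumr_ge0.
- move=> j; have [tj Bj _] := Hy j.
  apply: abssum_weak (l1_le_sub (polydisc_const t0 (Ht j)) Bj).
  by rewrite (bigD1 j) //= lerDl sumr_ge0.
move=> z tz; apply/rowP => j; rewrite mxE; have [tj _ ->] := Hy j => //.
by apply: polydisc_le tz; [apply: polydisc_const | apply: const_radii].
Qed.

Lemma monomial_le (d : K) (e : nat) (m : M) r : 0 <= d <= 1 ->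
  (forall i, 0 <= r 0 i <= d) -> (e <= \sum_i m i)%N -> monomial m r <= d ^+ e.
Proof.
move=> /andP[d0 d1] Hr em.
apply: (@le_trans _ _ (d ^+ (\sum_i m i))); last exact: ler_wiXn2l.
rewrite -prodrXr; apply: ler_prod => i _; have /andP[ri rd] := Hr i.
by rewrite exprn_ge0 //= lerXn2r // nnegrE.
Qed.

Lemma monomialM (m : M) r r' : monomial m (\row_i (r 0 i * r' 0 i)) = monomial m r *
    monomial m r'.
Proof. by rewrite -big_split; apply: eq_bigr => i _; rewrite mxE exprMn. Qed.

Lemma bounded_op_le r (C C' : K) k (H : F k -> F k.+1) : C <= C' ->
  bounded_op r C H -> bounded_op r C' H.
Proof.
move=> CC HC c Ac; have [A1 B1] := HC c Ac; split=> // B B0 Hc.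
by apply: form_l1_le_trans (B1 B B0 Hc); rewrite ler_wpM2r.
Qed.

(** Shrinking the polyradius by factors r_i multiplies the norm of the term of
    index m by r^m; this gains the factor d if the terms with r^m > d have been
    removed. *)
Lemma l1_le_scaled (t B d : K) r (x y : M -> K) : 0 < t -> 0 <= d -> pos_radii r ->
  l1_le (const_mx t) B x ->
  (forall m, y m = 0 \/ y m = x m /\ monomial m r <= d) ->
  l1_le (\row_i (r 0 i * t)) (d * B) y.
Proof.
move=> t0 d0 r0 Hx Hy.
have := abssumZ d Hx; rewrite ger0_norm //; apply: abssum_dominated => m.
have [->|[-> le]] := Hy m; first by rewrite mul0r normr0.
have -> : (\row_i (r 0 i * t)) = \row_i (r 0 i * (const_mx t : 'rV[K]_n) 0 i).
  by apply/rowP => i; rewrite !mxE.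
rewrite monomialM !normrM mulrCA (ger0_norm d0) ler_wpM2r ?mulr_ge0 //.
by rewrite ger0_norm // ltW // monomial_gt0.
Qed.

Lemma scale_choice (A : K) : 0 <= A -> exists d : K,
    [/\ 0 < d, d <= 1 & d * A <= 1].
Proof.
move=> A0; have A1 : 0 < A + 1 by rewrite ltr_wpDl.
exists (A + 1)^-1; split; first by rewrite invr_gt0.
  by rewrite invf_le1 // lerDr.
by rewrite mulrC ler_pdivrMr // mul1r lerDl.
Qed.

Lemma sum_index0 (m : M) : (\sum_i m i)%N = 0%N -> m = mzero n.
Proof.
move=> /eqP; rewrite sum_nat_eq0 => /forallP H; apply/ffunP => i; rewrite ffunE.
by apply/eqP; apply: (implyP (H i)).
Qed.

Lemma sum_index1 (m : M) : (\sum_i m i)%N = 1%N -> exists i, m = munit i.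
Proof.
move=> m1.
have [i mi] : exists i, m i != 0%N.
  apply: contrapT => /forallNP H.
  by move: m1; rewrite big1 // => i _; have /negP := H i; rewrite negbK => /eqP.
exists i; apply/ffunP => j; rewrite ffunE.
move: m1; rewrite (bigD1 i) //=; case E: (m i) mi => [|a] // _.
rewrite addSn => -[] /eqP; rewrite addn_eq0 => /andP[/eqP a0 s0].
case: eqP => [->|/eqP ji]; first by rewrite E a0.
by move: s0; rewrite (bigD1 j) //= addn_eq0 => /andP[/eqP].
Qed.

End Representation.

(** * The division property *)

Section Division.
Variables (R : realType) (n : nat).
Local Notation K := (Cplx R).
Local Notation T k := ('M[K]_(k, n) -> K).
Local Notation M := {ffun 'I_n -> nat}.
Local Notation F k := (M -> T k).
Implicit Types (r z v : 'rV[K]_n) (B : K).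

(** The field splits, at a polyradius below t, into a part x0 whose Koszul
    complex has a homotopy of norm at most C and a remainder N of norm at most
    eta, small enough for [solve_by_perturbation]. *)
Definition good_scale t (x : 'I_n -> M -> K) k (r : 'rV[K]_n) : Prop :=
  exists x0 N eta C (H : forall k, F k -> F k.+1),
  [/\ pos_radii r, polydisc (const_mx t) r, forall j, l1_le r eta (N j),
     (forall j l, x j l = x0 j l + N j l) /\
         [/\ 0 <= C, 0 <= eta & n%:R * eta * C * 4 <= 1] &
     [/\ homotopy x0 k H, bounded_op r C (H k) & bounded_op r C (H k.+1)]].

(** The remainder X - X(0) has norm at most d B at polyradius d t, and the
    homotopy of the constant field X(0) is bounded independently of d. *)
Lemma good_scale_nonzero t B (x : 'I_n -> M -> K) k : 0 < t -> 0 <= B ->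
  (forall j, l1_le (const_mx t) B (x j)) -> (exists j, x j (mzero n) != 0) ->
  exists r, good_scale t x k r.
Proof.
move=> t0 B0 Hx [j xj].
pose v : 'rV[K]_n := \row_i x i (mzero n).
pose th : 'cV[K]_n := (x j (mzero n))^-1 *: delta_mx j 0.
have pv : covec th v = 1.
  by rewrite /covec /th -scalemxAr -colE !mxE mulVf.
have [U U0 HU] := norm_bound_fin (fun i => th i 0).
pose C := k.+2%:R * U.
have C0 : 0 <= C by rewrite mulr_ge0.
have A0 : 0 <= n%:R * B * C * 4 by rewrite !mulr_ge0.
have [d [d0 d1 dA]] := scale_choice A0.
pose rd : 'rV[K]_n := const_mx d.
pose r : 'rV[K]_n := \row_i (rd 0 i * t).
exists r, (fun i l => v 0 i * (l == mzero n)%:R),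
  (fun i l => x i l - v 0 i * (l == mzero n)%:R), (d * B), C,
      (fun _ c m => wedge th (c m)).
split.
- by move=> i; rewrite !mxE mulr_gt0.
- by move=> i; rewrite !mxE ger0_norm ?mulr_ge0 ?ler_piMl // ltW.
- move=> i; apply: (l1_le_scaled t0 (ltW d0) (const_radii d0) (Hx i)) => m.
  case: eqP => [->|/eqP m0]; first by left; rewrite mxE mulr1 subrr.
  right; rewrite mulr0 subr0; split=> //; rewrite -[leRHS]expr1; apply: monomial_le.
  + by rewrite ltW.
  + by move=> q; rewrite mxE lexx ltW.
  rewrite lt0n; apply: contra_neq m0; exact: sum_index0.
- split; first by move=> i l; rewrite addrC subrK.
  split=> //; first by rewrite mulr_ge0 // ltW.
  by move: dA; rewrite (_ : n%:R * (d * B) * C * 4 = d * (n%:R * B * C * 4)) //;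
      ring.
split.
- exact: homotopy_const.
- by apply: bounded_op_le (bounded_wedge r HU); rewrite ler_wpM2r // ler_nat.
- exact: bounded_wedge.
Qed.

(** Choose p independent rows of the Jacobian, of indices s a, and let x0 be
    the part of the linear terms of X that involves the coordinates z_(s a).  The
    radii are d t in these coordinates and d^2 t in the others.  What remains of
    X is linear in the other coordinates or of order two, hence of norm at most
    d^2 B, while the homotopy of x0 has norm at most C / (d t): the product is
    of order d. *)
Lemma good_scale_zero t B (x : 'I_n -> M -> K) (J : 'M[K]_n) p k : 0 < t -> 0 <=
    B ->
  (forall j, l1_le (const_mx t) B (x j)) -> (forall j, x j (mzero n) = 0) ->
  (forall i j, J i j = x j (munit i)) -> (p <= \rank J)%N -> (n < p + k.+1)%N ->
  exists r, good_scale t x k r.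
Proof.
move=> t0 B0 Hx x0 HJ rk lt.
pose f := maxrankfun J.
pose w := widen_ord rk.
have w_inj : injective w by move=> a b /(congr1 val) /= ab; apply: val_inj.
pose s a : 'I_n := f (w a).
have s_inj : injective s.
  by move=> a b /maxrankfun_inj /w_inj.
pose uf := rowsub f J.
have uf_free : row_free uf by apply: maxrowsub_free.
pose u : 'M[K]_(p, n) := rowsub s J.
pose th a : 'cV[K]_n := col (w a) (pinvmx uf).
have dual a b : covec (th a) (row b u) = (a == b)%:R.
  transitivity ((uf *m pinvmx uf) (w b) (w a)).
    by rewrite /covec !mxE; apply: eq_bigr => i _; rewrite !mxE.
  by rewrite mulmxVp // mxE (inj_eq w_inj) eq_sym.
have u_free : row_free u.
  apply/row_freeP; exists (\matrix_(i, a) th a i 0); apply/matrixP => i j.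
  rewrite [RHS]mxE eq_sym -dual /covec !mxE.
  by apply: eq_bigr => q _; rewrite !mxE.
have [C1 C10 HC1] := bounded_koszul_homotopy u th s (enum 'I_p) k.
have [C2 C20 HC2] := bounded_koszul_homotopy u th s (enum 'I_p) k.+1.
pose C := C1 + C2.
have C0 : 0 <= C by rewrite addr_ge0.
have A0 : 0 <= n%:R * B * C * 4 / t by rewrite divr_ge0 ?mulr_ge0 // ltW.
have [d [d0 d1 dA]] := scale_choice A0.
pose rd : 'rV[K]_n := \row_i (if i \in codom s then d else d ^+ 2).
have rd0 : pos_radii rd by move=> i; rewrite mxE; case: ifP; rewrite ?exprn_gt0.
have rdd i : 0 <= rd 0 i <= d.
  rewrite ltW //= mxE; case: ifP => // _.
  by rewrite expr2 ler_piMl // ltW.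
pose r : 'rV[K]_n := \row_i (rd 0 i * t).
have r0 : pos_radii r by move=> i; rewrite mxE mulr_gt0.
have rs a : d * t <= r 0 (s a) by rewrite !mxE codom_f.
exists r, (lin_series u s), (fun j l => x j l - lin_series u s j l),
  (d ^+ 2 * B), (C / (d * t)), (fun k =>
      @koszul_homotopy R n p u th s (enum 'I_p) k).
have dt0 : 0 < d * t by rewrite mulr_gt0.
split => //.
- move=> i; rewrite ger0_norm ?(ltW (r0 i)) // [leRHS]mxE [leLHS]mxE.
  by case/andP: (rdd i) => _ h; rewrite ler_piMl ?(le_trans h) // ltW.
- move=> j; apply: (l1_le_scaled t0 _ rd0 (Hx j)) => [|m];
    first by rewrite exprn_ge0 // ltW.
  case E : (\sum_i m i)%N => [|[|e]].
  + left; rewrite (sum_index0 E) x0 sub0r; apply/eqP; rewrite oppr_eq0; apply/eqP.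
    rewrite /lin_series big1 // => a _.
    case: eqP => [/ffunP/(_ (s a))|_]; last by rewrite mulr0.
    by rewrite !ffunE eqxx.
  + have [i mi] := sum_index1 E; rewrite {m E}mi.
    have mu b : (munit i == munit (s b)) = (i == s b).
      apply/eqP/eqP => [/ffunP/(_ i)|-> //]; rewrite !ffunE eqxx.
      by case: eqP.
    (* the coordinates z_(s a) cancel against x0, the others have small radius *)
    have [/codomP[a ia]|ni] := boolP (i \in codom s).
      left; rewrite /lin_series (bigD1 a) //= mu ia eqxx mulr1 big1 ?addr0 =>
          [|b ba].
        by rewrite mxE HJ subrr.
      by rewrite -ia mu ia (inj_eq s_inj) eq_sym (negbTE ba) mulr0.
    right; split.
      rewrite /lin_series big1 ?subr0 // => a _; rewrite mu.
      by case: eqP => [ia|_]; rewrite ?mulr0 //; rewrite ia codom_f in ni.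
    by rewrite monomial_munit mxE (negbTE ni).
  right; split; last first.
    apply: monomial_le => //; first by rewrite ltW.
    by rewrite E.
  rewrite /lin_series big1 ?subr0 // => a _.
  case: eqP => [ma|_]; last by rewrite mulr0.
  move: E; rewrite ma (bigD1 (s a)) //= ffunE eqxx big1 // => i /negbTE ia.
  by rewrite ffunE ia.
- split; first by move=> j l; rewrite addrC subrK.
  split; first by rewrite divr_ge0 // ltW.
    by rewrite mulr_ge0 // exprn_ge0 // ltW.
  move: dA; rewrite (_ : n%:R * (d ^+ 2 * B) * (C / (d * t)) * 4 = d *
      (n%:R * B * C * 4 / t)) //.
  by field; rewrite !gt_eqF.
split.
- exact: homotopy_linear.
- apply: bounded_op_le (HC1 r _ r0 dt0 rs); rewrite ler_pM2r ?invr_gt0 //.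
  by rewrite lerDl.
- apply: bounded_op_le (HC2 r _ r0 dt0 rs); rewrite ler_pM2r ?invr_gt0 //.
  by rewrite lerDr.
Qed.

(** The germ a is represented by a series c on a polydisc; that i_X a
    vanishes near 0 means that the coefficients of i_x c vanish. *)
Lemma division_of_good_scale (X : 'rV[K]_n -> 'rV[K]_n) (x : 'I_n -> M -> K) t0 B0 k
    :
  0 < t0 -> 0 <= B0 -> (forall j, l1_le (const_mx t0) B0 (x j)) ->
  (forall z, polydisc (const_mx t0) z -> X z = \row_j series_ev (x j) z) ->
  (forall t, 0 < t -> t <= t0 -> exists r, good_scale t x k r) ->
  division_property X k.+1.
Proof.
move=> t00 B00 Hx HX good a Ha /= Xa.
have [c [t1 [B [Ac t10 Bnn Hc Ec]]]] := form_series Ha.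
have [t [tp tt0 tt1]] := pos_lower_bound2 t00 t10.
have pt0 := polydisc_const tp tt0 (n := n);
    have pt1 := polydisc_const tp tt1 (n := n).
have rt := @const_radii R n _ tp.
have Hxt j := l1_le_sub pt0 (Hx j).
have Hct := form_l1_le_weak pt1 (lexx _) Hc.
have ixc m V : field_contr x c m V = 0.
  have [CV _ HV] := form_l1_le_at V.
  have nearX : \forall z \near (0 : 'rV[K]_n), polydisc (const_mx t) z ->
      series_ev (fun m => field_contr x c m V) z = 0.
    apply: filterS2 Ec Xa => z Ez Xz tz.
    rewrite -[LHS]/(form_ev (field_contr x c) z V)
        (form_ev_field_contr _ rt tz Hxt Ac Hct) -HX;
        last exact: polydisc_le pt0 rt tz.
    by rewrite /contr -Ez Xz.
  have /nbhs_rowP[e e0 He] := nearX.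
  apply: (series_ev_eq0 rt (HV _ _ _ (field_contr_Alt x Ac)
      (form_l1_le_field_contr rt Hxt Hct)) e0
      (c := fun m => field_contr x c m V)) => z tz ez.
  by apply: He => // i; rewrite mxE subr0.
have [r [x0 [N [eta [C [H [r0 rr HN [xE [C0 eta0 small]] [h0 h1 h2]]]]]]]] :=
    good t tp tt0.
have Hcr := form_l1_le_weak rr (lexx _) Hct.
have [b [B' [Ab Hb Eb]]] := solve_by_perturbation r0 (fun j => l1_le_sub rr (Hxt j))
    HN xE C0 eta0 small h0 h1 h2 Bnn Ac Hcr ixc.
exists (fun z V => form_ev b z V); split.
  split.
    by apply: filterS (near_polydisc r0) => z rz; apply/AltP;
        apply: form_ev_Alt rz Ab Hb.
  move=> V; have [CV _ HV] := form_l1_le_at V.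
  exact: series_ev_holomorphic r0 (HV _ _ _ Ab Hb).
apply: filterS2 Ec (near_polydisc r0) => z Ez rz V.
rewrite Ez Eb // /contr HX //.
by apply: polydisc_le pt0 rt _; apply: polydisc_le rr r0 rz.
Qed.

End Division.

(* The library's 'J is the transpose of the usual Jacobian matrix, since it acts
   on row vectors; the rank is the same. *)
Theorem proposition5p17 (R : realType) (n p : nat)
    (X : 'rV[Cplx R]_n -> 'rV[Cplx R]_n)
    (p_gt0 : (0 < p)%N)
    (X_holo : holomorphic_vector_field X)
    (rank_DX0 : (p + 1 <= \rank ('J X (0%R : 'rV[Cplx R]_n)))%N)
    (k : nat) (k_range : (n - p <= k <= n - 1)%N) :
  division_property X k.
Proof.
have [x [t [B [t0 B0 Hx HX]]]] := vector_series X_holo.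
have pn : (p + 1 <= n)%N := leq_trans rank_DX0 (rank_leq_row _).
case/andP: k_range => kp _.
case: k kp => [|k kp].
  by rewrite leqn0 subn_eq0 leqNgt -addn1 pn.
apply: (division_of_good_scale t0 B0 Hx HX) => s s0 st.
have Hs j := l1_le_sub (polydisc_const s0 st) (Hx j).
have [nz|/forallNP z0] := pselect (exists j, x j (mzero n) != 0).
  exact: good_scale_nonzero s0 B0 Hs nz.
apply: (@good_scale_zero R n s B x ('J X 0) (p + 1)) => //.
- by move=> j; apply/eqP/negPn/negP/z0.
- apply: (jacobian_coef t0 Hx) => [z j /HX -> |]; first by rewrite mxE.
  by apply: contraTneq rank_DX0 => ->; rewrite mxrank0 addn1.
by move: kp; rewrite leq_subLR addnAC addn1.
Qed.
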